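(* Let $p,q\ge0$ be integers with $n=p+q\ge2$. If $n\ge3$, then the $\mathfrak{u}(p,q)$-module $\mathcal{R}^\nabla(\mathfrak{u}(p,q))$ admits the following decomposition into a direct sum of irreducible $\mathfrak{u}(p,q)$-modules: $$\mathcal{R}^\nabla(\mathfrak{u}(p,q))=\mathcal{Q}_0\oplus\mathcal{Q}'\oplus\mathcal{Q}_1\simeq V_{3\pi_1+2\pi_{n-1}}\oplus V_{\pi_1+2\pi_{n-1}}\oplus\mathbb{R}^{2p,2q}.$$ If $n=2$, then $$\mathcal{R}^\nabla(\mathfrak{u}(p,q))=\mathcal{Q}_0\oplus\mathcal{Q}'\oplus\mathcal{Q}_1\simeq\mathbb{C}^6\oplus\mathbb{C}^4\oplus\mathbb{R}^{2p,2q},$$ where $\mathbb{C}^6$ and $\mathbb{C}^4$ denote irreducible $\mathfrak{u}(p,q)$-modules of complex dimension $6$ and $4$.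
   Context: $\mathbb{R}^{2p,2q}$ is a pseudo-Euclidean space with metric $g$ of signature $(2p,2q)$ and a $g$-orthogonal complex structure $J$; $\mathfrak{u}(p,q)\subset\mathfrak{so}(2p,2q)$ is the subalgebra of elements commuting with $J$, acting on $\mathbb{R}^{2p,2q}$ by the standard representation. For a subalgebra $\mathfrak{h}\subset\mathfrak{so}(2p,2q)$, $$\mathcal{R}(\mathfrak{h})=\{R\in\mathrm{Hom}(\Lambda^2\mathbb{R}^{2p,2q},\mathfrak{h})\mid R(X,Y)Z+R(Y,Z)X+R(Z,X)Y=0\},$$ $$\mathcal{R}^\nabla(\mathfrak{h})=\{S\in\mathrm{Hom}(\mathbb{R}^{2p,2q},\mathcal{R}(\mathfrak{h}))\mid S_X(Y,Z)+S_Y(Z,X)+S_Z(X,Y)=0\}.$$ The element $J\in\mathfrak{u}(p,q)$ acts on $\mathcal{R}^\nabla(\mathfrak{u}(p,q))$ by the complex structure $(J\cdot S)_X=S_{-JX}$. Here $\pi_1,\dots,\pi_{n-1}$ are the fundamental weights of $\mathfrak{sl}(n,\mathbb{C})$ ($\pi_1$ the highest weight of $\mathbb{C}^n$, $\pi_{n-1}$ that of $(\mathbb{C}^n)^*$), and $V_\Lambda$ denotes the irreducible complex $\mathfrak{gl}(n,\mathbb{C})$-module whose restriction to $\mathfrak{sl}(n,\mathbb{C})$ has highest weight $\Lambda$, regarded as a (real) $\mathfrak{u}(p,q)$-module by restriction along $\mathfrak{u}(p,q)\subset\mathfrak{gl}(n,\mathbb{C})$. The action of scalar matrices is the one coming from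 realizing $V_{3\pi_1+2\pi_{n-1}}$ in $(\mathbb{C}^n)^{\otimes3}\otimes((\mathbb{C}^n)^* )^{\otimes2}$ and $V_{\pi_1+2\pi_{n-1}}$ in $\odot^2(\mathbb{C}^n)^*\otimes\mathbb{C}^n$; in particular $V_{\pi_1+2\pi_{n-1}}\simeq(\odot^2(\mathbb{C}^n)^*\otimes\mathbb{C}^n)_0$, the subspace of tensors for which the contraction of the upper index with a lower index is zero. For $n=2$, $\mathbb{C}^6$ and $\mathbb{C}^4$ are likewise restrictions to $\mathfrak{u}(p,q)$ of irreducible $\mathfrak{gl}(2,\mathbb{C})$-modules of these dimensions, with $J$ acting as a complex structure. Irreducibility is meant for real $\mathfrak{u}(p,q)$-modules. *)

(* Defs.v *)
From HB Require Import structures.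
From mathcomp Require Import all_boot all_order all_algebra.
From mathcomp Require Import sesquilinear complex.
From mathcomp Require Import classical_sets reals.

Set Implicit Arguments.
Unset Strict Implicit.
Unset Printing Implicit Defensive.

Import GRing.Theory Num.Theory.
Local Open Scope ring_scope.
Local Open Scope classical_set_scope.

Section PseudoEuclidean.
Variables (R : realType) (V : vectType R).
Implicit Types (g : {symmetric V}) (J A : 'End(V)).

(* Convention: the first [r] vectors are the positive ones.  Replacing [g] by
   [- g] changes neither [so_algebra g] nor [u_algebra g J]. *)
Definition signature g (r s : nat) : Prop :=
  exists b : (r + s).-tuple V, basis_of fullv b /\
    forall i j : 'I_(r + s),
      g b`_i b`_j = if i != j then 0 else if (i < r)%N then 1 else -1.

Definition orthogonal_complex_structure g J : Prop :=
  (forall x, J (J x) = - x) /\ (forall x y, g (J x) (J y) = g x y).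

Definition so_algebra g : set 'End(V) :=
  [set A | forall x y, g (A x) y + g x (A y) = 0].

Definition u_algebra g J : set 'End(V) :=
  so_algebra g `&` [set A | (A \o J)%VF = (J \o A)%VF].

(* A linear map from the exterior square of V is encoded as an alternating
   bilinear map; [R_space] and [S_space] are the ambient spaces of all
   multilinear maps with values in End(V). *)
Definition R_space : vectType R := 'Hom(V, 'Hom(V, 'End(V))).
Definition S_space : vectType R := 'Hom(V, R_space).

Definition curvature_space (h : set 'End(V)) : set R_space :=
  [set K : R_space |
    [/\ forall X, K X X = 0,
        forall X Y, h (K X Y)
      & forall X Y Z, K X Y Z + K Y Z X + K Z X Y = 0]].

Definition nabla_curvature_space (h : set 'End(V)) : set S_space :=
  [set S : S_space |
    (forall X, curvature_space h (S X)) /\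
    (forall X Y Z, S X Y Z + S Y Z X + S Z X Y = 0)].

End PseudoEuclidean.

Section Actions.
Variable R : realType.

(* The infinitesimal action f |-> b o f - f o a on Hom(U, W). *)
Definition hom_act (U W : vectType R) (a : 'End(U)) (b : 'End(W)) :
    'End('Hom(U, W)) :=
  linfun (fun f : 'Hom(U, W) => ((b \o f) - (f \o a))%VF).

Lemma hom_actE (U W : vectType R) (a : 'End(U)) (b : 'End(W)) f :
  hom_act a b f = ((b \o f) - (f \o a))%VF.
Proof.
pose F (f : 'Hom(U, W)) := ((b \o f) - (f \o a))%VF.
have linF : linear F.
  move=> k f1 f2; apply/lfunP => x.
  rewrite /F !(add_lfunE, opp_lfunE, scale_lfunE, comp_lfunE).
  by rewrite linearD linearZ scalerBr opprD addrACA.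
pose FM := GRing.isLinear.Build R 'Hom(U, W) 'Hom(U, W) *:%R F linF.
pose FL : {linear 'Hom(U, W) -> 'Hom(U, W)} := HB.pack F FM.
exact: (lfunE FL).
Qed.

Definition S_act (V : vectType R) (A : 'End(V)) : 'End(S_space V) :=
  hom_act A (hom_act A (hom_act A (hom_act A A))).

Lemma S_actE (V : vectType R) (A : 'End(V)) (S : S_space V) X Y Z W :
  S_act A S X Y Z W = A (S X Y Z W) - S X Y Z (A W)
    - S X Y (A Z) W - S X (A Y) Z W - S (A X) Y Z W.
Proof.
by rewrite /S_act !(hom_actE, add_lfunE, opp_lfunE, comp_lfunE).
Qed.

End Actions.

Definition irreducible (F : fieldType) (T : vectType F) (E : set 'End(T))
    (Q : {vspace T}) : Prop :=
  let stable (W : {vspace T}) := forall a, E a -> (a @: W <= W)%VS in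
  [/\ Q != 0%VS, stable Q
    & forall W : {vspace T}, (W <= Q)%VS -> stable W -> W = 0%VS \/ W = Q].

(* With [scale] the restriction of scalars of a complex space to R, this is
   isomorphism of real modules; [f] matters only on [Q]. *)
Definition module_iso (R : realType) (V T : vectType R) (h : set 'End(V))
    (actT : 'End(V) -> 'End(T)) (Q : {vspace T})
    (N : zmodType) (scale : R -> N -> N) (actN : 'End(V) -> N -> N) : Prop :=
  exists f : {linear T -> N | scale},
    [/\ {in Q &, injective f},
        forall y, exists2 x, x \in Q & f x = y
      & forall A x, h A -> x \in Q -> f (actT A x) = actN A (f x)].

Section GLModules.
Variables (R : realType) (n : nat).
Local Notation C := (R[i]).

(* The matrix of a J-linear endomorphism in the coordinates [phi]; this is the
   embedding of u(p,q) in gl(n,C). *)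
Definition gl_mx (V : vectType R) (phi : V -> 'cV[C]_n) (psi : 'cV[C]_n -> V)
    (A : 'End(V)) : 'M[C]_n :=
  \matrix_(i, j) phi (A (psi (delta_mx j 0))) i 0.

Lemma gl_mxE (V : vectType R) (J A : 'End(V))
    (phi : {linear V -> 'cV[C]_n | real_complex R \; *:%R})
    (psi : 'cV[C]_n -> V) v :
  cancel phi psi -> cancel psi phi -> (forall w, phi (J w) = 'i%C *: phi w) ->
  (A \o J)%VF = (J \o A)%VF -> phi (A v) = gl_mx phi psi A *m phi v.
Proof.
move=> phiK psiK phiJ AJ.
have AJE w : A (J w) = J (A w) by rewrite -!comp_lfunE AJ.
have psiD x y : psi (x + y) = psi x + psi y.
  by rewrite -[RHS]phiK linearD !psiK.
have psi0 : psi 0 = 0 by rewrite -[RHS]phiK linear0.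
have psiZ (c : C) x :
    psi (c *: x) = complex.Re c *: psi x + complex.Im c *: J (psi x).
  rewrite -[RHS]phiK linearD !linearZ /= phiJ psiK scalerA -scalerDl.
  by congr (psi (_ *: _)); rewrite [LHS]complexE mulrC.
have APD w1 w2 : phi (A (psi (w1 + w2))) = phi (A (psi w1)) + phi (A (psi w2)).
  by rewrite psiD !linearD.
have AP0 : phi (A (psi 0)) = 0 by rewrite psi0 !linear0.
have APZ (c : C) w : phi (A (psi (c *: w))) = c *: phi (A (psi w)).
  rewrite psiZ linearD !linearZ /= AJE linearD !linearZ /= phiJ scalerA.
  by rewrite -scalerDl [in RHS](complexE c) mulrC.
rewrite -{1}(phiK v); set x := phi v.
have {1}-> : x = \sum_j x j 0 *: delta_mx j 0.
  by rewrite {1}[x]matrix_sum_delta; apply: eq_bigr => j _; rewrite big_ord1.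
rewrite (big_morph (fun w => phi (A (psi w))) APD AP0).
apply/matrixP => i k; rewrite ord1 summxE !mxE.
by apply: eq_bigr => j _; rewrite APZ !mxE mulrC.
Qed.

Variables (M : vectType C) (rho : {linear 'M[C]_n -> 'End(M)}).

Definition gl_irreducible : Prop :=
  (forall A B : 'M[C]_n,
    rho (A *m B - B *m A) = ((rho A \o rho B) - (rho B \o rho A))%VF) /\
  irreducible (range rho) fullv.

(* [fund_weight k] is pi_k, evaluated on diagonal matrices. *)
Definition fund_weight (k : nat) (H : 'M[C]_n) : C :=
  \sum_(i < n | (i < k)%N) H i i.

(* Highest weight for sl(n,C), with respect to its diagonal Cartan subalgebra
   and the Borel subalgebra of upper triangular matrices. *)
Definition has_highest_weight (L : 'M[C]_n -> C) : Prop :=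
  exists2 v : M, v != 0 &
    (forall E : 'M[C]_n, (forall i j : 'I_n, (j <= i)%N -> E i j = 0) ->
       rho E v = 0) /\
    (forall H : 'M[C]_n, is_diag_mx H -> \tr H = 0 -> rho H v = L H *: v).

(* V_(a pi_1 + b pi_(n-1)); scalar matrices act as on the tensors with a
   factors C^n and b factors (C^n)^*. *)
Definition is_V (a b : nat) : Prop :=
  [/\ gl_irreducible,
      has_highest_weight
        (fun H => a%:R * fund_weight 1 H + b%:R * fund_weight n.-1 H)
    & forall c : C, rho c%:M = ((a%:R - b%:R) * c) *: \1%VF].

End GLModules.

Section Claims.
Variables (R : realType) (n : nat) (V : vectType R).
Variables (g : {symmetric V}) (J : 'End(V)).
Variables (phi : V -> 'cV[R[i]]_n) (psi : 'cV[R[i]]_n -> V).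
Implicit Types (Q : {vspace S_space V}).

Definition irreducible_decomposition Q0 Q' Q1 : Prop :=
  [/\ nabla_curvature_space (u_algebra g J) = [set S | S \in (Q0 + Q' + Q1)%VS],
      directv (Q0 + Q' + Q1),
      irreducible (@S_act R V @` u_algebra g J) Q0,
      irreducible (@S_act R V @` u_algebra g J) Q'
    & irreducible (@S_act R V @` u_algebra g J) Q1].

Definition iso_gl Q (M : vectType R[i])
    (rho : {linear 'M[R[i]]_n -> 'End(M)}) : Prop :=
  module_iso (u_algebra g J) (@S_act R V) Q (real_complex R \; *:%R)
    (fun A => rho (gl_mx phi psi A)).

Definition iso_V Q (a b : nat) : Prop :=
  exists (M : vectType R[i]) (rho : {linear 'M[R[i]]_n -> 'End(M)}),
    is_V rho a b /\ iso_gl Q rho.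

(* An irreducible gl(n,C)-module of complex dimension [d] on which [J] acts as
   a complex structure. *)
Definition iso_C Q (d : nat) : Prop :=
  exists (M : vectType R[i]) (rho : {linear 'M[R[i]]_n -> 'End(M)}),
    [/\ gl_irreducible rho, \dim (fullv : {vspace M}) = d,
        forall v, rho (gl_mx phi psi J) (rho (gl_mx phi psi J) v) = - v
      & iso_gl Q rho].

Definition iso_standard Q : Prop :=
  module_iso (u_algebra g J) (@S_act R V) Q *:%R (fun A : 'End(V) => A : V -> V).

End Claims.

(* Main.v *)
Require Import Defs.
From HB Require Import structures.
From mathcomp Require Import all_boot all_order all_fingroup all_algebra.
From mathcomp Require Import sesquilinear complex.
From mathcomp Require Import classical_sets reals boolp.
From mathcomp Require Import ring lra zify.

(** All three tensor types that occur, (2,3), (1,2) and (0,1), have exactly one more lower than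
    upper slot, so [J] acts on each of them by the scalar -i. This one number closes the real
    submodules under i. On type (0,1) the antilinear identification of covectors with vectors
    through h gives the standard real module itself. Irreducibility is proved without complete
    reducibility or the classification of modules. What makes this possible is that the Casimir
    value minus the eigenvalue of a monomial is a sum of nonnegative terms, one for each slot and
    each pair of slots, and the slot terms vanish together at one monomial only. The argument treats
    any finite set of slots, so it is run once for all types and for all n at least 2; for n = 2
    only the dimensions remain to be counted. *)

(* Write h(x,y) = g(x,y) + i g(x,Jy).  For S in R^nabla(u(p,q)) the component of
   S_X(Y,Z)W that is complex linear in X, Y, W and antilinear in Z determines S,
   is symmetric in X, Y, W, and, after raising Z by h, is a tensor with two
   symmetric upper and three symmetric lower indices; every such tensor arises.
   Under gl(n,C) the symmetric tensors of type (2,3) are the direct sum of the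
   traceless ones of types (2,3), (1,2) and (0,1), the last two multiplied by
   powers of the invariant tensor of type (1,1).

   Traceless tensors form an irreducible gl(n,C)-module: the quadratic Casimir
   operator is a scalar on them, while on vectors killed by all E_ij, i < j, it
   acts diagonally on monomials and takes that value at a single monomial.  The
   argument also applies to quotients, so every nonzero submodule contains this
   monomial and no proper quotient survives.  J acts on R^nabla as a complex
   structure and u(p,q) + i u(p,q) = gl(n,C), so the real submodules are the
   complex gl(n,C)-submodules.  The type (2,3) summand becomes V_(3 pi_1 + 2
   pi_(n-1)) after complex conjugation, which exchanges V and its dual. *)

Set Implicit Arguments.
Unset Strict Implicit.
Unset Printing Implicit Defensive.

Import Order.TTheory GRing.Theory Num.Theory.
Local Open Scope ring_scope.

(** * Tensors and the action of gl(n) *)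

(** Turns a [Prop]-valued closed predicate, on which no boolean test is available, into a
    [{vspace T}]: a subspace inside [P] is enlarged by a missing vector until none is left, which
    stops because the dimension grows. *)
Lemma subspace_of_pred (F : fieldType) (T : vectType F) (P : T -> Prop) :
  P 0 -> (forall k x y, P x -> P y -> P (k *: x + y)) ->
  exists W : {vspace T}, forall x, x \in W <-> P x.
Proof.
move=> P0 PD.
(* [d] bounds the codimension of the part of [P] found so far. *)
suff H d (W : {vspace T}) : (forall x, x \in W -> P x) ->
    (\dim {:T} - \dim W <= d)%N -> exists W : {vspace T}, forall x, x \in W <-> P x.
  by apply: (H (\dim {:T}) 0%VS) => [x|]; rewrite ?memv0 ?leq_subr // => /eqP ->.
elim: d W => [|d IHd] W PW hd.
  exists W => x; split=> [|_]; first exact: PW.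
  suff -> : W = fullv by rewrite memvf.
  by apply/eqP; rewrite eqEdim subvf /=; lia.
have [[x [xW Px]]|noX] := EM (exists x, x \notin W /\ P x); last first.
  exists W => x; split=> [|Px]; first exact: PW.
  by apply/negPn/negP => xW; apply: noX; exists x.
apply: (IHd (W + <[x]>)%VS).
  move=> _ /memv_addP[u uW [_ /vlineP[k ->] ->]].
  by rewrite addrC; apply: PD => //; exact: PW.
suff : (\dim W < \dim (W + <[x]>))%N by lia.
rewrite ltnNge; apply: contraNN xW => hle.
have /eqP -> : W == (W + <[x]>)%VS by rewrite eqEdim addvSl.
by rewrite memvE addvSr.
Qed.

Section Tensors.
Variables (F : numFieldType) (n : nat) (I : finType).
Local Notation idx := {ffun I -> 'I_n}.

(** Tensors are arrays of coordinates over an arbitrary finite set [I] of slots, so that all types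
    share one irreducibility proof. *)
Definition tensor : vectType F := {ffun idx -> F^o}.
Implicit Types (T : tensor) (w : idx) (s t : I) (A B : 'M[F]_n).

Definition coef T w : F := T w.
Definition mkt (f : idx -> F) : tensor := [ffun w => f w].

Lemma coefE f w : coef (mkt f) w = f w. Proof. by rewrite /coef ffunE. Qed.
Lemma coefD T1 T2 w : coef (T1 + T2) w = coef T1 w + coef T2 w.
Proof. by rewrite /coef ffunE. Qed.
Lemma coefZ k T w : coef (k *: T) w = k * coef T w.
Proof. by rewrite /coef ffunE. Qed.
Lemma coef0 w : coef 0 w = 0. Proof. by rewrite /coef ffunE. Qed.
Lemma coefN T w : coef (- T) w = - coef T w. Proof. by rewrite /coef ffunE. Qed.
Lemma coef_sum (K : Type) (r : seq K) (P : pred K) (f : K -> tensor) w :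
  coef (\sum_(k <- r | P k) f k) w = \sum_(k <- r | P k) coef (f k) w.
Proof. exact: (big_morph (coef^~ w) (fun x y => coefD x y w) (coef0 w)). Qed.

Lemma tensorP T1 T2 : (forall w, coef T1 w = coef T2 w) -> T1 = T2.
Proof. by move=> h; apply/ffunP => w; exact: h. Qed.

Definition upd w s c : idx := [ffun t => if t == s then c else w t].

Lemma upd_same w s c : upd w s c s = c. Proof. by rewrite ffunE eqxx. Qed.
Lemma upd_other w s t c : t != s -> upd w s c t = w t.
Proof. by rewrite ffunE => /negbTE ->. Qed.
Lemma updK w s c d : upd (upd w s c) s d = upd w s d.
Proof. by apply/ffunP => t; rewrite !ffunE; case: eqP. Qed.
Lemma upd_id w s : upd w s (w s) = w.
Proof. by apply/ffunP => t; rewrite !ffunE; case: eqP => [->|]. Qed.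
Lemma updC w s t c d : s != t -> upd (upd w s c) t d = upd (upd w t d) s c.
Proof.
move=> st; apply/ffunP => x; rewrite !ffunE.
by case: (eqVneq x t) => // ->; rewrite eq_sym (negbTE st).
Qed.

Definition slot s A T : tensor :=
  mkt (fun w => \sum_c A (w s) c * coef T (upd w s c)).

Lemma slotP s A k T1 T2 : slot s A (k *: T1 + T2) = k *: slot s A T1 + slot s A T2.
Proof.
apply: tensorP => w; rewrite coefD coefZ !coefE mulr_sumr -big_split /=.
by apply: eq_bigr => c _; rewrite coefD coefZ; ring.
Qed.

Lemma slotPl s k A B T : slot s (k *: A + B) T = k *: slot s A T + slot s B T.
Proof.
apply: tensorP => w; rewrite coefD coefZ !coefE mulr_sumr -big_split /=.
by apply: eq_bigr => c _; rewrite !mxE; ring.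
Qed.

Lemma slotM s A B T : slot s A (slot s B T) = slot s (A *m B) T.
Proof.
apply: tensorP => w; rewrite !coefE.
under eq_bigr => c _ do rewrite coefE mulr_sumr.
rewrite exchange_big /=; apply: eq_bigr => c _.
rewrite !mxE mulr_suml; apply: eq_bigr => d _.
by rewrite upd_same updK; ring.
Qed.

Lemma slotC s t A B T : s != t -> slot s A (slot t B T) = slot t B (slot s A T).
Proof.
move=> st; have ts : t != s by rewrite eq_sym.
apply: tensorP => w; rewrite !coefE.
under eq_bigr => c _ do rewrite coefE mulr_sumr.
under [RHS]eq_bigr => c _ do rewrite coefE mulr_sumr.
rewrite exchange_big /=; apply: eq_bigr => c _; apply: eq_bigr => d _.
by rewrite updC // !upd_other //; ring.
Qed.

(* The slots in [up] carry the standard representation, the others its dual. *)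
Variable up : pred I.

Definition smx s B : 'M[F]_n := if up s then B else - B^T.
Definition tact B T : tensor := \sum_s slot s (smx s B) T.

Lemma smxP s k A B : smx s (k *: A + B) = k *: smx s A + smx s B.
Proof.
by rewrite /smx; case: ifP => // _; rewrite linearP opprD scalerN.
Qed.

Lemma smx_comm s A B :
  smx s A *m smx s B - smx s B *m smx s A = smx s (A *m B - B *m A).
Proof.
rewrite /smx; case: ifP => // _.
by rewrite !(mulNmx, mulmxN) !opprK -!trmx_mul [in RHS]linearB opprB.
Qed.

Lemma tactP B k T1 T2 : tact B (k *: T1 + T2) = k *: tact B T1 + tact B T2.
Proof. by rewrite scaler_sumr -big_split; apply: eq_bigr => s _; exact: slotP. Qed.

Lemma tactPl k A B T : tact (k *: A + B) T = k *: tact A T + tact B T.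
Proof.
rewrite scaler_sumr -big_split; apply: eq_bigr => s _.
by rewrite /= smxP slotPl.
Qed.

Lemma tact_is_linear B : linear (tact B). Proof. by move=> k x y; exact: tactP. Qed.
HB.instance Definition _ B := GRing.isLinear.Build F tensor tensor *:%R (tact B)
  (@tact_is_linear B).
Lemma slot_is_linear s B : linear (slot s B). Proof. by move=> k x y; exact: slotP. Qed.
HB.instance Definition _ s B := GRing.isLinear.Build F tensor tensor *:%R (slot s B)
  (@slot_is_linear s B).

Lemma slotBl s A B T : slot s (A - B) T = slot s A T - slot s B T.
Proof. by rewrite addrC -scaleN1r slotPl scaleN1r addrC. Qed.

Lemma slotNl s A T : slot s (- A) T = - slot s A T.
Proof.
apply: tensorP => w; rewrite coefN !coefE -sumrN.
by apply: eq_bigr => c _; rewrite mxE mulNr.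
Qed.

Lemma tactBl A B T : tact (A - B) T = tact A T - tact B T.
Proof. by rewrite addrC -scaleN1r tactPl scaleN1r addrC. Qed.

Lemma tact_comm A B T : tact (A *m B - B *m A) T = tact A (tact B T) - tact B (tact A T).
Proof.
rewrite /tact.
under [X in _ = X - _]eq_bigr => s _ do rewrite linear_sum.
under [X in _ = _ - X]eq_bigr => s _ do rewrite linear_sum.
rewrite [X in _ = _ - X]exchange_big -sumrB; apply: eq_bigr => s _.
rewrite -sumrB (bigD1 s) //= big1 ?addr0 => [|t ts].
  by rewrite !slotM -slotBl smx_comm.
by rewrite slotC 1?eq_sym // subrr.
Qed.

(** Symmetry among slots of equal variance is part of the notion: with a upper and b lower slots
    this is the Cartan component of Sym^a(F^n) tensor Sym^b of the dual. *)
Definition traceless T : Prop :=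
  (forall s t w, up s = up t -> coef T (upd (upd w s (w t)) t (w s)) = coef T w) /\
  (forall s t w, up s != up t -> \sum_c coef T (upd (upd w s c) t c) = 0).

Definition submodule (U : tensor -> Prop) : Prop :=
  [/\ U 0, forall k x y, U x -> U y -> U (k *: x + y)
    & forall B x, U x -> U (tact B x)].

(** * The Casimir operator on traceless tensors *)

Local Notation E i j := (delta_mx i j : 'M[F]_n).

Lemma sum_delta (a : 'I_n) (f : 'I_n -> F) : \sum_i (a == i)%:R * f i = f a.
Proof.
rewrite (bigD1 a) //= eqxx mul1r big1 ?addr0 // => i /negbTE ia.
by rewrite eq_sym ia mul0r.
Qed.

Definition eps s : F := if up s then 1 else -1.

Lemma coef_slot_delta s i j T w : coef (slot s (E i j) T) w =
  (w s == i)%:R * coef T (upd w s j).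
Proof.
rewrite coefE (bigD1 j) //= big1 => [|c /negbTE cj]; rewrite mxE ?cj ?andbF ?mul0r //.
by rewrite eqxx andbT addr0.
Qed.

Lemma slot_smx_delta s i j T : slot s (smx s (E i j)) T =
  eps s *: slot s (if up s then E i j else E j i) T.
Proof.
rewrite /smx /eps; case: ifP => _; first by rewrite scale1r.
by rewrite trmx_delta slotNl scaleN1r.
Qed.

Lemma coef_slot_smx s i j T w : coef (slot s (smx s (E i j)) T) w =
  eps s * ((w s == (if up s then i else j))%:R *
    coef T (upd w s (if up s then j else i))).
Proof.
by rewrite slot_smx_delta coefZ; case: ifP => _; rewrite coef_slot_delta.
Qed.

(** On two slots of equal variance the sum of E_ij tensor E_ji exchanges the two indices, which
    symmetry makes the identity. On slots of opposite variance it factors through their contraction,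
    which is zero. On a single slot it is multiplication by n. *)
Lemma casimir_slots s t T w : traceless T ->
  \sum_i \sum_j coef (slot s (smx s (E i j)) (slot t (smx t (E j i)) T)) w =
  (if s == t then n%:R else (up s == up t)%:R) * coef T w.
Proof.
case=> symT trT.
under eq_bigr => i _ do under eq_bigr => j _ do rewrite !coef_slot_smx.
case: (eqVneq s t) => [<-|st].
  have E2 x y : eps s * (x * (eps s * y)) = x * y by rewrite /eps; case: ifP => _; ring.
  transitivity (\sum_(i < n) coef T w); last by rewrite sumr_const card_ord mulr_natl.
  case: (up s); first rewrite exchange_big /=; apply: eq_bigr => i _;
    under eq_bigr => j _ do rewrite upd_same updK eqxx mul1r E2;
    by rewrite sum_delta upd_id.
have ts : t != s by rewrite eq_sym.
transitivity (eps s * eps t * \sum_i \sum_j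
    (w s == if up s then i else j)%:R * ((w t == if up t then j else i)%:R *
    coef T (upd (upd w s (if up s then j else i)) t (if up t then i else j)))).
  rewrite mulr_sumr; apply: eq_bigr => i _; rewrite mulr_sumr.
  by apply: eq_bigr => j _; rewrite upd_other //; ring.
rewrite /eps; have := symT s t w; have := trT s t w.
case: (up s); case: (up t) => //= Htr Hsym.
- rewrite exchange_big /=; under eq_bigr => j _ do rewrite sum_delta.
  by rewrite sum_delta Hsym // !mul1r.
- rewrite exchange_big /=; under eq_bigr => j _ do rewrite sum_delta.
  by rewrite -mulr_sumr Htr // !mulr0 mul0r.
- under eq_bigr => i _ do rewrite sum_delta.
  by rewrite -mulr_sumr Htr // !mulr0 mul0r.
- under eq_bigr => i _ do rewrite sum_delta.
  by rewrite sum_delta Hsym //; ring.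
Qed.

(** For a upper and b lower slots this is a^2 + b^2 + (a + b)(n - 1). The diagonal s = t of the
    double sum accounts for 1 out of the n contributed by each slot. *)
Definition cas : F := \sum_s \sum_t (up s == up t)%:R + \sum_(s : I) (n%:R - 1).

Lemma casimir T : traceless T ->
  \sum_i \sum_j tact (E i j) (tact (E j i) T) = cas *: T.
Proof.
move=> hT; apply: tensorP => w; rewrite coefZ coef_sum.
under eq_bigr => i _.
  rewrite coef_sum.
  under eq_bigr => j _.
    rewrite coef_sum.
    under eq_bigr => s _ do rewrite linear_sum coef_sum.
    over.
  rewrite exchange_big /=.
  under eq_bigr => s _ do rewrite exchange_big /=.
  over.
rewrite exchange_big /=.
under eq_bigr => s _ do rewrite exchange_big /=.
under eq_bigr => s _ do under eq_bigr => t _ do rewrite casimir_slots //.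
rewrite /cas -big_split mulr_suml; apply: eq_bigr => s _ /=.
rewrite (bigD1 s) //= eqxx [in RHS](bigD1 s) //= eqxx.
rewrite (_ : 1 + _ + _ = n%:R + \sum_(t | t != s) (up s == up t)%:R); last by ring.
rewrite mulrDl mulr_suml; congr (_ + _); apply: eq_bigr => t /negbTE.
by rewrite eq_sym => ->.
Qed.

Definition mu w i : F := \sum_s eps s * (w s == i)%:R.
(** The value on the monomial [w] of the Cartan part of the Casimir operator, that is (mu, mu + 2
    rho) for the weight [mu w]. *)
Definition eig w : F :=
  \sum_i mu w i * mu w i + \sum_(i < n) \sum_(j : 'I_n | (i < j)%N) (mu w i - mu w j).

Lemma coef_tact_diag i T w : coef (tact (E i i) T) w = mu w i * coef T w.
Proof.
rewrite coef_sum mulr_suml; apply: eq_bigr => s _; rewrite coef_slot_smx if_same.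
by case: eqP => [<-|_]; rewrite ?upd_id ?mul1r ?mulr1 ?mul0r ?mulr0 ?mul0r.
Qed.

Lemma sum_square (N : nmodType) (f : 'I_n -> 'I_n -> N) :
  \sum_i \sum_j f i j =
  \sum_i f i i + \sum_(i < n) \sum_(j : 'I_n | (i < j)%N) (f i j + f j i).
Proof.
under [X in _ = _ + X]eq_bigr => i _ do rewrite big_split.
rewrite [X in _ = _ + X]big_split /=.
rewrite [X in _ = _ + (_ + X)](exchange_big_dep predT) //=.
rewrite -!big_split /=; apply: eq_bigr => i _.
rewrite (bigD1 i) //=; congr (_ + _).
rewrite (bigID (fun j : 'I_n => (i < j)%N)) /=; congr (_ + _); apply: eq_bigl => j.
  by rewrite andbC; case: (ltngtP i j) => // ij; rewrite -val_eqE /= neq_ltn ij ?orbT.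
by rewrite andbC -val_eqE /=; case: (ltngtP i j).
Qed.

(** For i < j, replace E_ij E_ji by E_ji E_ij + E_ii - E_jj: the Casimir operator becomes its Cartan
    part plus twice the sum of the E_ji E_ij. *)
Lemma casimir_raising T w : traceless T ->
  coef (\sum_(i < n) \sum_(j : 'I_n | (i < j)%N) tact (E j i) (tact (E i j) T)) w * 2 =
  (cas - eig w) * coef T w.
Proof.
move=> hT; have := congr1 (coef^~ w) (casimir hT).
rewrite sum_square /= coefD coefZ !coef_sum => h.
rewrite mulrBl -{}h /eig mulrDl [X in _ - (X + _)]mulr_suml.
under [X in X + _ - _]eq_bigr => i _ do rewrite !coef_tact_diag mulrA.
rewrite opprD addrACA subrr add0r [LHS]mulr_suml [in RHS]mulr_suml -sumrB.
apply: eq_bigr => i _; rewrite !coef_sum !mulr_suml -sumrB; apply: eq_bigr => j ij.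
have := congr1 (coef^~ w) (tact_comm (E i j) (E j i) T).
rewrite (mul_delta_mx j i i) (mul_delta_mx i j j) tactBl !coefD !coefN (coef_tact_diag i)
  (coef_tact_diag j) => h.
have {}h : coef (tact (E i j) (tact (E j i) T)) w =
  coef (tact (E j i) (tact (E i j) T)) w + (mu w i - mu w j) * coef T w by rewrite mulrBl
    h addrC subrK.
by rewrite h; ring.
Qed.

Lemma sum_muE w : \sum_i mu w i * mu w i =
  \sum_s \sum_t eps s * eps t * (w s == w t)%:R.
Proof.
under eq_bigr => i _ do rewrite mulr_suml.
rewrite exchange_big; apply: eq_bigr => s _ /=.
under eq_bigr => i _ do rewrite mulr_sumr.
rewrite exchange_big; apply: eq_bigr => t _ /=.
transitivity (\sum_i (w s == i)%:R * (eps s * eps t * (w t == i)%:R)).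
  by apply: eq_bigr => i _; ring.
by rewrite sum_delta eq_sym.
Qed.

Lemma sum_ltl (x : F) (j : 'I_n) : \sum_(i < n | (i < j)%N) x = x * j%:R.
Proof.
have <- : \sum_(i < j) x = \sum_(i < n | (i < j)%N) x.
  exact: big_ord_widen n (fun=> x) (ltnW (ltn_ord j)).
by rewrite sumr_const card_ord mulr_natr.
Qed.

Lemma sum_ltr (x : F) (i : 'I_n) : \sum_(j < n | (i < j)%N) x = x * (n%:R - 1 - i%:R).
Proof.
have E1 m : \sum_(j < m) x = x * m%:R by rewrite sumr_const card_ord mulr_natr.
have E2 : \sum_(j < i.+1) x = \sum_(j < n | (j < i.+1)%N) x.
  exact: big_ord_widen n (fun=> x) (ltn_ord i).
have : \sum_(j < n) x = \sum_(j < n | (j < i.+1)%N) x + \sum_(j < n | ~~ (j < i.+1)%N) x.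
  exact: bigID.
rewrite -E2 !E1 -addrA -opprD [1 + _]addrC natr1 mulrBr => ->.
rewrite addrC addKr; apply: eq_bigl => j; by rewrite -leqNgt.
Qed.

(** The coordinate of 2 rho at [a]: there are n - 1 - a larger indices and a smaller ones. *)
Lemma sum_gtE (a : 'I_n) :
  \sum_(i < n) \sum_(j : 'I_n | (i < j)%N) ((a == i)%:R - (a == j)%:R) =
  n%:R - 1 - 2 * a%:R :> F.
Proof.
under eq_bigr => i _ do rewrite big_split sum_ltr /=.
rewrite big_split sum_delta (exchange_big_dep predT) //=.
under [X in _ + X]eq_bigr => i _ do rewrite sum_ltl mulNr.
by rewrite sumrN sum_delta; ring.
Qed.

(** * The highest weight monomial *)

Variables i0 i1 : 'I_n.
Hypotheses (i0E : i0 = 0%N :> nat) (i1E : i1 = n.-1 :> nat) (i01 : i0 != i1).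

Definition top : idx := [ffun s => if up s then i0 else i1].

Lemma cas_subE w : cas - eig w =
  \sum_s \sum_t ((up s == up t)%:R - eps s * eps t * (w s == w t)%:R) +
  \sum_s (n%:R - 1 - eps s * (n%:R - 1 - 2 * (w s)%:R)).
Proof.
under [X in _ = X + _]eq_bigr => s _ do rewrite sumrB.
rewrite !sumrB addrACA -opprD /eig sum_muE; congr (_ - (_ + _));
  first by rewrite /cas !sumrB.
under eq_bigr => i _ do under eq_bigr => j _ do rewrite /mu -sumrB.
under eq_bigr => i _ do rewrite exchange_big /=.
rewrite exchange_big /=; apply: eq_bigr => s _.
rewrite -sum_gtE mulr_sumr; apply: eq_bigr => i _.
by rewrite mulr_sumr; apply: eq_bigr => j _; rewrite mulrBr.
Qed.

(** The slot term is twice the distance from the index [w s] to the index that [top] has in that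
    slot, hence nonnegative. *)
Lemma cas_sub_slot w s : n%:R - 1 - eps s * (n%:R - 1 - 2 * (w s)%:R) =
  (2 * (if up s then w s : nat else n.-1 - w s)%N)%:R :> F.
Proof.
rewrite /eps natrM; case: (up s); first by ring.
by have wn := ltn_ord (w s); rewrite natrB -?subn1 ?natrB; [ring|lia|lia].
Qed.

Lemma eig_top : eig top = cas.
Proof.
apply/eqP; rewrite eq_sym -subr_eq0 cas_subE !big1 ?addr0 // => s _.
  rewrite cas_sub_slot ffunE; case: (up s); rewrite ?i0E ?i1E ?subnn //.
rewrite big1 // => t _; rewrite /eps !ffunE.
by case: (up s); case: (up t);
  rewrite ?eqxx ?(negbTE i01) ?[i1 == i0]eq_sym ?(negbTE i01) /=; ring.
Qed.

(* Both sums in [cas_subE] are termwise nonnegative; the second one vanishes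
   only at [top]. *)
Lemma cas_eig w : cas = eig w -> w = top.
Proof.
move=> /eqP; rewrite -subr_eq0 cas_subE.
have ge1 s t : 0 <= (up s == up t)%:R - eps s * eps t * (w s == w t)%:R.
  rewrite /eps; case: (up s); case: (up t); case: (w s == w t);
    rewrite /= ?(mul1r, mulr1, mulN1r, mulrN1, mulr0, opprK, oppr0, subr0, subrr, sub0r)
    ?ler01 ?lexx //.
have S1 : 0 <= \sum_s \sum_t ((up s == up t)%:R - eps s * eps t * (w s == w t)%:R).
  by apply: sumr_ge0 => s _; apply: sumr_ge0.
have S2 : 0 <= \sum_s (n%:R - 1 - eps s * (n%:R - 1 - 2 * (w s)%:R)).
  by apply: sumr_ge0 => s _; rewrite cas_sub_slot ler0n.
rewrite paddr_eq0 // => /andP[_]; rewrite psumr_eq0 => [/allP Hz|s _].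
  apply/ffunP => s; rewrite ffunE; apply: val_inj.
  have := Hz s (mem_index_enum s); rewrite cas_sub_slot pnatr_eq0.
  by have := ltn_ord (w s); case: (up s); rewrite /= ?i0E ?i1E; lia.
by rewrite cas_sub_slot ler0n.
Qed.

(** * Raising operators and irreducibility *)

Definition height w : nat := \sum_s (if up s then w s : nat else n - w s)%N.

(** A coefficient of E_ij T at [w] is read from T at a multi-index where an upper i has become j or
    a lower j has become i. For i < j both replacements increase [height], so E_ij lowers the top
    height of the support. *)
Lemma tact_raise (i j : 'I_n) T m : (i < j)%N ->
  (forall w, (m.+1 <= height w)%N -> coef T w = 0) ->
  forall w, (m <= height w)%N -> coef (tact (E i j) T) w = 0.
Proof.
move=> ij Tm w mw; rewrite coef_sum big1 // => s _; rewrite coef_slot_smx.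
case: eqP => [wsE|_]; last by rewrite mul0r mulr0.
rewrite Tm ?mulr0 //; apply: leq_ltn_trans mw _.
rewrite /height (bigD1 s) //= [X in (_ < X)%N](bigD1 s) //= upd_same.
rewrite (eq_bigr (fun t => (if up t then upd w s (if up s then j else i) t : nat
  else n - upd w s (if up s then j else i) t)%N)) => [|t ts]; last by rewrite upd_other.
rewrite ltn_add2r wsE; have := ltn_ord j; case: (up s); lia.
Qed.

(** Existence of a highest weight vector in the quotient of [P] by [U]: apply raising operators as
    long as the result avoids [U]. The height bound drops each time, and at bound 0 the vector would
    be 0, which lies in [U]. *)
Lemma exists_raised (P U : tensor -> Prop) v : submodule P -> submodule U ->
  P v -> ~ U v ->
  exists x, [/\ P x, ~ U x & forall i j : 'I_n, (i < j)%N -> U (tact (E i j) x)].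
Proof.
move=> [_ _ Ps] [U0 _ _] Pv Uv.
have [m hm] : exists m, forall w, (m <= height w)%N -> coef v w = 0.
  (* One more than the largest height, so the condition is vacuous. *)
  exists (\max_w height w).+1 => w; rewrite ltnNge => /negP[].
  exact: (leq_bigmax w).
elim: m v Pv Uv hm => [|m IHm] v Pv Uv hm.
  by case: Uv; rewrite (_ : v = 0) //; apply: tensorP => w; rewrite coef0 hm.
have [H|/existsNP[i /existsNP[j /not_implyP[ij Uij]]]] :=
  EM (forall i j : 'I_n, (i < j)%N -> U (tact (E i j) v)); first by exists v.
by apply: (IHm (tact (E i j) v)) => //; [exact: Ps | exact: tact_raise hm].
Qed.

Lemma submoduleD U x y : submodule U -> U x -> U y -> U (x + y).
Proof. by case=> _ UP _ Ux Uy; rewrite -[x]scale1r; exact: UP. Qed.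

Lemma submoduleZ U k x : submodule U -> U x -> U (k *: x).
Proof. by case=> U0 UP _ Ux; rewrite -[_ *: x]addr0; exact: UP. Qed.

Lemma submoduleB U x y : submodule U -> U x -> U y -> U (x - y).
Proof. by move=> sU Ux Uy; rewrite -scaleN1r; apply: submoduleD => //;
  exact: submoduleZ. Qed.

Lemma submodule_sum U (K : Type) (r : seq K) (P : pred K) (f : K -> tensor) :
  submodule U -> (forall k, P k -> U (f k)) -> U (\sum_(k <- r | P k) f k).
Proof.
move=> sU Uf; apply: (big_ind U) => //; first by case: sU.
by move=> x y; exact: submoduleD.
Qed.

(* cas - sum_i E_ii^2 - sum_(i<j) (E_ii - E_jj), which agrees with
   2 sum_(i<j) E_ji E_ij on traceless tensors. *)
Definition casX T : tensor := mkt (fun w => (cas - eig w) * coef T w).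

(** [casX] is a polynomial in the diagonal operators E_ii alone, so it preserves every submodule, on
    traceless tensors or not. *)
Lemma submodule_casX U T : submodule U -> U T -> U (casX T).
Proof.
move=> sU UT; have UE i j x : U x -> U (tact (E i j) x) by case: sU => _ _; exact.
rewrite (_ : casX T = cas *: T - (\sum_i tact (E i i) (tact (E i i) T) +
  \sum_(i < n) \sum_(j : 'I_n | (i < j)%N) (tact (E i i) T - tact (E j j) T))).
  apply: submoduleB => //; first exact: submoduleZ.
  apply: submoduleD => //; apply: submodule_sum => // i _; first by apply/UE/UE.
  by apply: submodule_sum => // j _; apply: submoduleB => //; exact: UE.
apply: tensorP => w; rewrite coefE coefD coefN coefZ coefD !coef_sum mulrBl.
congr (_ - _); rewrite /eig mulrDl !mulr_suml; congr (_ + _); apply: eq_bigr => i _.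
  by rewrite !coef_tact_diag mulrA.
rewrite coef_sum mulr_suml; apply: eq_bigr => j _.
by rewrite coefD coefN !coef_tact_diag mulrBl.
Qed.

(** [casX] is diagonal on monomials, with nonzero eigenvalues in [es] on the support of [x].
    Subtracting e times [x] from [casX x] removes the monomials of eigenvalue e, so induction on
    [es] inverts [casX] inside [U]. *)
Lemma casX_cancel U (es : seq F) x : submodule U -> 0 \notin es ->
  (forall w, coef x w != 0 -> cas - eig w \in es) -> U (casX x) -> U x.
Proof.
move=> sU; have [U0 _ _] := sU.
elim: es x => [|e es IHes] x.
  move=> _ hx _; rewrite (_ : x = 0) //; apply: tensorP => w; rewrite coef0.
  by apply/eqP/negPn/negP => /hx; rewrite in_nil.
rewrite inE negb_or => /andP[e0 es0] hx Ux.
have Uy : U (casX x - e *: x).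
  apply: IHes => // [w|].
    rewrite coefD coefN coefZ coefE -mulrBl mulf_eq0 negb_or => /andP[h1 /hx].
    by rewrite inE -subr_eq0 (negbTE h1).
  rewrite (_ : casX _ = casX (casX x) - e *: casX x).
    by apply: submoduleB => //; [exact: submodule_casX | exact: submoduleZ].
  by apply: tensorP => w; rewrite !(coefD, coefN, coefZ, coefE); ring.
rewrite (_ : x = e^-1 *: (casX x - (casX x - e *: x))).
  by apply: submoduleZ => //; exact: submoduleB.
by rewrite subKr scalerA mulVf ?scale1r 1?eq_sym.
Qed.

Lemma raised_top U x : submodule U -> traceless x ->
  (forall i j : 'I_n, (i < j)%N -> U (tact (E i j) x)) ->
  exists k, U (x - k *: mkt (fun w => (w == top)%:R)).
Proof.
move=> sU hx Ux; exists (coef x top).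
(* Once the coefficient at [top] is removed, only eigenvalues at other monomials remain; by
   [cas_eig] none of them is zero. *)
apply: (casX_cancel (es := [seq cas - eig w | w in predC1 top])) => //.
- apply/negP => /fintype.imageP[w]; rewrite inE /= => wt /esym/eqP.
  by rewrite subr_eq0 => /eqP/cas_eig/eqP; rewrite (negbTE wt).
- move=> w; rewrite coefD coefN coefZ coefE => h; apply/fintype.imageP; exists w => //.
  by rewrite inE; apply: contraNN h => /eqP ->; rewrite eqxx mulr1 subrr.
(* [casX] annihilates the removed monomial, since [eig top] equals [cas]; and [casX x] is twice the
   sum of the E_ji E_ij x, which lies in [U]. *)
rewrite (_ : casX _ = casX x).
  rewrite (_ : casX x = (2 : F) *: \sum_(i < n) \sum_(j : 'I_n | (i < j)%N)
      tact (E j i) (tact (E i j) x)).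
    apply: submoduleZ => //; do 2!apply: submodule_sum => // ? ?.
    by case: sU => _ _; apply; exact: Ux.
  by apply: tensorP => w; rewrite coefE coefZ -casimir_raising // mulrC.
apply: tensorP => w; rewrite !(coefD, coefN, coefZ, coefE).
have [->|_] := eqVneq w top; last by rewrite mulr0 subr0.
by rewrite eig_top subrr !mul0r.
Qed.

Theorem traceless_irreducible U : submodule U -> submodule traceless ->
  (forall x, U x -> traceless x) ->
  (exists2 x, U x & x != 0) -> forall x, traceless x -> U x.
Proof.
move=> sU sW UW [x0 Ux0 x0N0] x Wx.
have s0 : submodule (fun x => x = 0).
  by split=> [|k y z -> ->|B y ->] //; [rewrite scaler0 addr0 | exact: linear0].
pose e := mkt (fun w => (w == top)%:R).
(* A highest weight vector of [U] itself (quotient by zero) must be a nonzero multiple of [e]. *)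
have Ue : U e.
  have [y [Uy /eqP y0 Ey]] := exists_raised sU s0 Ux0 (fun h => negP x0N0 (introT eqP h)).
  have [k /subr0_eq yk] := raised_top s0 (UW _ Uy) Ey.
  have k0 : k != 0 by apply: contraNneq y0 => k0; rewrite yk k0 scale0r.
  by rewrite -[e]scale1r -(mulVf k0) -scalerA -yk; exact: submoduleZ.
apply: contrapT => NUx.
have [y [Wy NUy Ey]] := exists_raised sW sU Wx NUx.
have [k Uyk] := raised_top sU Wy Ey; apply: NUy.
by rewrite -(subrK (k *: e) y); apply: submoduleD => //; exact: submoduleZ.
Qed.

End Tensors.

(** * Traceless tensors as a gl(n)-module *)

Section TracelessModule.
Variables (F : numFieldType) (n : nat) (I : finType) (up : pred I).
Local Notation idx := {ffun I -> 'I_n}.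
Local Notation tensor := (tensor F n I).
Implicit Types (T : tensor) (w : idx) (s t : I) (A B : 'M[F]_n).

Definition permute (p : {perm I}) w : idx := [ffun s => w (p s)].

Lemma permute_tperm w s t : permute (tperm s t) w = upd (upd w s (w t)) t (w s).
Proof.
apply/ffunP => r; rewrite !ffunE.
case: tpermP => [->|->|/eqP/negbTE rs /eqP/negbTE rt]; rewrite ?eqxx ?rs ?rt //.
by case: eqP => [->|].
Qed.

Lemma upd_permute_tperm w s t r c :
  upd (permute (tperm s t) w) r c = permute (tperm s t) (upd w (tperm s t r) c).
Proof.
apply/ffunP => x; rewrite !ffunE.
by rewrite (can_eq (tpermK s t)).
Qed.

Lemma up_tperm s t r : up s = up t -> up (tperm s t r) = up r.
Proof. by case: tpermP => [->|->|]. Qed.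

Lemma coef_tact B T w :
  coef (tact up B T) w = \sum_s \sum_c smx up s B (w s) c * coef T (upd w s c).
Proof. by rewrite coef_sum; apply: eq_bigr => s _; rewrite coefE. Qed.

(** Exchanging slots of equal variance only permutes the terms of the action. In a contraction, the
    terms with [B] on the two contracted slots cancel, as one slot carries [B] and the other minus
    its transpose; any other slot leaves a contraction of T. *)
Lemma traceless_tact B T : traceless up T -> traceless up (tact up B T).
Proof.
case=> symT trT; split=> s t w.
  move=> st; rewrite -permute_tperm !coef_tact.
  rewrite (reindex_inj (@perm_inj _ (tperm s t))) /=; apply: eq_bigr => r _.
  apply: eq_bigr => c _;
    rewrite upd_permute_tperm tpermK [permute _ (upd w r c)]permute_tperm symT //.
  by rewrite ffunE tpermK /smx up_tperm.
move=> st; have sNt : s != t by apply: contraNneq st => ->.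
have tNs : t != s by rewrite eq_sym.
under eq_bigr => c _ do rewrite coef_tact.
rewrite exchange_big /= (bigD1 s) //= (bigD1 t) //= addrA [X in _ + X]big1 ?addr0.
  under eq_bigr => c _ do under eq_bigr => d _ do
    rewrite upd_other // upd_same -updC // updK.
  under [X in _ + X]eq_bigr => c _ do under eq_bigr => d _ do
    rewrite upd_same updK.
  rewrite [X in _ + X]exchange_big /= -big_split big1 //= => c _.
  rewrite -big_split big1 //= => d _.
  rewrite /smx; move: st; case: (up s); case: (up t) => //= _; rewrite !mxE; ring.
move=> r /andP[rs rt]; rewrite exchange_big big1 //= => c _.
rewrite (eq_bigr (fun d => smx up r B (w r) c *
    coef T (upd (upd (upd w r c) s d) t d))) => [|d _].
  by rewrite -mulr_sumr trT ?mulr0.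
rewrite !upd_other //; congr (_ * coef T _); apply/ffunP => x; rewrite !ffunE.
by case: (eqVneq x r) => [->|//]; rewrite (negbTE rs) (negbTE rt).
Qed.

Lemma traceless_submodule : submodule up (@traceless F n I up).
Proof.
split=> [|k x y [sx tx] [sy ty]|B x]; last exact: traceless_tact.
  by split=> [s t w|s t w] *; rewrite ?coef0 ?big1 // => c _; rewrite coef0.
split=> s t w h; first by rewrite !coefD !coefZ sx ?sy.
under eq_bigr => c _ do rewrite coefD coefZ.
by rewrite big_split -mulr_sumr /= tx ?ty ?mulr0 ?addr0.
Qed.

Lemma tact_scalar c T : tact up c%:M T = ((\sum_s eps F up s) * c) *: T.
Proof.
apply: tensorP => w; rewrite coef_tact coefZ !mulr_suml; apply: eq_bigr => s _.
rewrite (bigD1 (w s)) //= big1 ?addr0 => [|d /negbTE dw].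
  by rewrite upd_id /smx /eps; case: (up s); rewrite !mxE eqxx ?mulr1n; ring.
rewrite /smx; case: (up s); rewrite !mxE 1?eq_sym ?dw ?mulr0n ?oppr0 ?mul0r //.
by rewrite eq_sym dw oppr0 mul0r.
Qed.

(** Source of highest weight vectors. General [u] and [l] are allowed because the conjugated action
    has other eigenvectors than the standard basis. *)
Definition pure (u : 'cV[F]_n) (l : 'rV[F]_n) : tensor :=
  mkt (fun w => \prod_s if up s then u (w s) 0 else l 0 (w s)).

Lemma coef_pure_upd u l w s c : coef (pure u l) (upd w s c) =
  (if up s then u c 0 else l 0 c) *
  \prod_(t | t != s) if up t then u (w t) 0 else l 0 (w t).
Proof.
rewrite coefE (bigD1 s) //= upd_same; congr (_ * _).
by apply: eq_bigr => t ts; rewrite upd_other.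
Qed.

Lemma tact_pure B u l x y : B *m u = x *: u -> l *m B = y *: l ->
  tact up B (pure u l) = (\sum_s if up s then x else - y) *: pure u l.
Proof.
move=> Bu lB; apply: tensorP => w; rewrite coef_tact coefZ mulr_suml.
apply: eq_bigr => s _; under eq_bigr => c _ do rewrite coef_pure_upd mulrA.
rewrite -mulr_suml -[in RHS](upd_id w s) coef_pure_upd [RHS]mulrA; congr (_ * _).
rewrite /smx; case: (up s).
  by have := congr1 (fun M : 'cV_n => M (w s) 0) Bu; rewrite !mxE.
have := congr1 (fun M : 'rV_n => M 0 (w s)) lB; rewrite !mxE mulNr => <-.
by rewrite -sumrN; apply: eq_bigr => c _; rewrite !mxE mulNr mulrC.
Qed.

Lemma traceless_pure u l : l *m u = 0 -> traceless up (pure u l).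
Proof.
move=> lu; split=> s t w.
  move=> st; rewrite -permute_tperm !coefE (reindex_inj (@perm_inj _ (tperm s t))) /=.
  by apply: eq_bigr => r _; rewrite ffunE tpermK up_tperm.
move=> st; have tNs : t != s by apply: contraNneq st => ->.
under eq_bigr => c _ do rewrite coef_pure_upd (bigD1 s) 1?eq_sym //= upd_same mulrA.
rewrite (eq_bigr (fun c => (l 0 c * u c 0) * (\prod_(r | (r != t) && (r != s))
  if up r then u (w r) 0 else l 0 (w r)))) => [|c _].
  by rewrite -mulr_suml; have := congr1 (fun M : 'M_1 => M 0 0) lu; rewrite !mxE => ->;
    rewrite mul0r.
congr (_ * _); first by move: st; case: (up s); case: (up t) => //= _; rewrite mulrC.
by apply: eq_bigr => r /andP[_ rs]; rewrite upd_other.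
Qed.

Lemma pure_neq0 u l : u != 0 -> l != 0 -> pure u l != 0.
Proof.
move=> /cV0Pn[i ui] /rV0Pn[j lj].
apply/negP => /eqP/(congr1 (fun T => coef T [ffun s => if up s then i else j])).
rewrite coefE coef0 => /eqP; rewrite prodf_seq_eq0 => /hasP[s _ /=].
by rewrite ffunE; case: (up s); [rewrite (negbTE ui) | rewrite (negbTE lj)].
Qed.

Variable W : {vspace tensor}.

(** The projection only brings the value back into the subtype; by [vsval_rep] it changes nothing
    when [W] is the space of traceless tensors. *)
Definition rep B : 'End(subvs_of W) :=
  linfun (vsproj W \o tact up B \o vsval).

Lemma repE B x : rep B x = vsproj W (tact up B (vsval x)).
Proof. by rewrite lfunE. Qed.

Lemma rep_is_linear : linear rep.
Proof.
move=> k A B; apply/lfunP => x.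
by rewrite add_lfunE scale_lfunE !repE tactPl linearP.
Qed.
HB.instance Definition _ := GRing.isLinear.Build F 'M[F]_n 'End(subvs_of W) *:%R rep
  rep_is_linear.

Hypothesis WP : forall T, T \in W <-> traceless up T.

Lemma vsval_rep B x : vsval (rep B x) = tact up B (vsval x).
Proof. by rewrite repE vsprojK //; apply/WP/traceless_tact/WP/subvsP. Qed.

Lemma rep_comm A B : rep (A *m B - B *m A) = ((rep A \o rep B) - (rep B \o rep A))%VF.
Proof.
apply/lfunP => x; apply: val_inj => /=.
by rewrite vsval_rep tact_comm add_lfunE opp_lfunE !comp_lfunE [in RHS]linearB /=
  !vsval_rep.
Qed.

End TracelessModule.

(** * The dimension of traceless tensors for n = 2 *)

Section BinaryForms.
Variables (F : numFieldType) (I : finType) (up : pred I).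
Local Notation idx := {ffun I -> 'I_2}.
Local Notation tensor := (tensor F 2 I).
Implicit Types (T : tensor) (w : idx) (s t : I).

(* For n = 2 the volume form identifies the dual of F^2 with F^2, and traceless
   tensors become symmetric tensors in all slots, that is, functions of the
   number of indices equal to 1. *)
Definition bit w s : bool := (w s == 1) (+) ~~ up s.
Definition cnt w : nat := \sum_s bit w s.
Definition sgn w : F := \prod_s (-1) ^+ (~~ up s && (w s == 1)).
Definition flip (c : 'I_2) : 'I_2 := if c == 0 then 1 else 0.

Lemma ord2 (c : 'I_2) : c = 0 \/ c = 1.
Proof. by case: c => [[|[|//]] ?]; [left|right]; exact: val_inj. Qed.

Lemma sgn2 w : sgn w * sgn w = 1.
Proof. by rewrite -big_split big1 //= => s _; rewrite -expr2 sqrr_sign. Qed.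

Lemma cnt_le w : (cnt w <= #|I|)%N.
Proof. by rewrite -sum1_card leq_sum // => s _; exact: leq_b1. Qed.

Lemma cnt_split w s t : s != t ->
  cnt w = (bit w s + bit w t + \sum_(r | (r != s) && (r != t)) bit w r)%N.
Proof. by move=> st; rewrite /cnt (bigD1 s) //= (bigD1 t) 1?eq_sym //= addnA. Qed.

Lemma sgn_split w s t : s != t ->
  sgn w = (-1) ^+ (~~ up s && (w s == 1)) * (-1) ^+ (~~ up t && (w t == 1)) *
    \prod_(r | (r != s) && (r != t)) (-1) ^+ (~~ up r && (w r == 1)).
Proof. by move=> st; rewrite /sgn (bigD1 s) //= (bigD1 t) 1?eq_sym //= mulrA. Qed.

Definition upd2 w s t c d := upd (upd w s c) t d.

Lemma cnt_upd2 w s t c d : s != t ->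
  cnt (upd2 w s t c d) = (((c == 1)%R (+) ~~ up s)%B + ((d == 1)%R (+) ~~ up t)%B +
    \sum_(r | (r != s) && (r != t)) bit w r)%N.
Proof.
move=> st; rewrite (cnt_split _ st) /bit upd_same upd_other // upd_same.
by congr (_ + _)%N; apply: eq_bigr => r /andP[rs rt]; rewrite !upd_other.
Qed.

Lemma sgn_upd2 w s t c d : s != t ->
  sgn (upd2 w s t c d) = (-1) ^+ (~~ up s && (c == 1)) * (-1) ^+ (~~ up t && (d == 1)) *
    \prod_(r | (r != s) && (r != t)) (-1) ^+ (~~ up r && (w r == 1)).
Proof.
move=> st; rewrite (sgn_split _ st) upd_same upd_other // upd_same.
by congr (_ * _); apply: eq_bigr => r /andP[rs rt]; rewrite !upd_other.
Qed.

Lemma upd2_id w s t : upd2 w s t (w s) (w t) = w.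
Proof. by rewrite /upd2 upd_id upd_id. Qed.

(** If the bits differ, flipping both indices swaps the bits. For equal variance this is the
    symmetry of T. For opposite variance the contraction has just two terms, whose sum is zero;
    [sgn] absorbs the resulting sign. *)
Lemma bit_swap T w s t : traceless up T -> s != t -> bit w s != bit w t ->
  sgn w * coef T w =
  sgn (upd2 w s t (flip (w s)) (flip (w t))) * coef T (upd2 w s t (flip (w s)) (flip (w
    t))).
Proof.
move=> [symT trT] st; rewrite -[in sgn w](upd2_id w s t) !sgn_upd2 // /bit.
case: (boolP (up s == up t)) => [/eqP ut|ut].
  rewrite -(symT s t w ut) ut /upd2 /flip.
  case: (ord2 (w s)) => ->; case: (ord2 (w t)) => ->; case: (up t) => //= _;
    rewrite ?expr0 ?expr1; ring.
have := trT s t w ut; rewrite big_ord_recl big_ord1 => trw.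
rewrite -[in coef T w](upd2_id w s t) /upd2.
have e1 : lift ord0 ord0 = 1 :> 'I_2 by exact: val_inj.
rewrite e1 in trw; have {}trw := addr0_eq trw.
move: ut trw; case: (ord2 (w s)) => ->; case: (ord2 (w t)) => -> //;
  case: (up s); case: (up t) => //= _ trw _; rewrite /flip /= -trw; ring.
Qed.

Lemma ex_bit w w' : cnt w = cnt w' -> w != w' ->
  exists s, bit w s && ~~ bit w' s.
Proof.
move=> cE /eqP ww'; apply/existsP; apply: contra_notT ww' => /existsPn H.
have le s : (bit w s <= bit w' s)%N by have := H s; case: bit; case: bit.
apply/ffunP => s; apply/eqP/negPn/negP => ws.
suff : (cnt w < cnt w')%N by rewrite cE ltnn.
rewrite /cnt (bigD1 s) //= [X in (_ < X)%N](bigD1 s) //= -addSn leq_add //.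
  by have := H s; move: ws; rewrite /bit; case: (ord2 (w s)) => ->;
    case: (ord2 (w' s)) => ->; case: (up s).
by apply: leq_sum.
Qed.

Lemma traceless_cnt T w w' : traceless up T -> cnt w = cnt w' ->
  sgn w * coef T w = sgn w' * coef T w'.
Proof.
move=> hT; have [m] := ubnP #|[pred s | w s != w' s]|.
elim: m w => // m IHm w hm cE.
have [->//|ww'] := eqVneq w w'.
(* Equal counts give a slot where only [w] has bit 1 and another where only [w'] has it; swapping
   them makes [w] agree with [w'] at both slots. *)
have [s /andP[s1 s0]] := ex_bit cE ww'.
have w'w : w' != w by rewrite eq_sym.
have [t /andP[t1 t0]] := ex_bit (esym cE) w'w.
have st : s != t by apply: contraNneq t0 => <-.
rewrite (bit_swap hT st) ?s1 ?(negbTE t0) //; apply: IHm.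
  rewrite -ltnS; apply: leq_trans hm; rewrite ltnS; apply: proper_card.
  apply/fintype.properP; split.
    apply/fintype.subsetP => r; rewrite !inE !ffunE; case: (eqVneq r t) => [->|_].
      by move: t0 t1; rewrite /bit /flip; case: (ord2 (w t)) => ->;
        case: (ord2 (w' t)) => ->; case: (up t).
    case: (eqVneq r s) => [->|//].
    by move: s0 s1; rewrite /bit /flip; case: (ord2 (w s)) => ->;
      case: (ord2 (w' s)) => ->; case: (up s).
  exists s; rewrite !inE ?ffunE.
    by apply: contraTneq s1; rewrite /bit => ->.
  rewrite (negbTE st) eqxx negbK.
  by move: s0 s1; rewrite /bit /flip; case: (ord2 (w s)) => ->;
    case: (ord2 (w' s)) => ->; case: (up s).
rewrite -{}cE cnt_upd2 // (cnt_split w st); congr (_ + _)%N.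
by move: s1 t0; rewrite /bit /flip; case: (ord2 (w s)) => ->; case: (ord2 (w t)) => ->;
  case: (up s); case: (up t).
Qed.

Definition binary (v : 'rV[F]_(#|I|.+1)) : tensor :=
  mkt (fun w => sgn w * v 0 (inord (cnt w))).

Lemma binary_is_linear : linear binary.
Proof.
move=> k v1 v2; apply: tensorP => w.
by rewrite coefD coefZ !coefE !mxE; ring.
Qed.
HB.instance Definition _ :=
  GRing.isLinear.Build F 'rV[F]_(#|I|.+1) tensor *:%R binary binary_is_linear.

Lemma traceless_binary v : traceless up (binary v).
Proof.
split=> s t w.
  have [->|st] := eqVneq s t; first by rewrite upd_id upd_id.
  move=> ut; rewrite !coefE -/(upd2 _ _ _ _ _) cnt_upd2 // sgn_upd2 // (cnt_split w st)
    (sgn_split w st) ut.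
  congr (_ * _ * v 0 (inord _)); first by rewrite mulrC.
  by rewrite /bit ut; congr (_ + _)%N; exact: addnC.
move=> ut; have st : s != t by apply: contraNneq ut => ->.
rewrite big_ord_recl big_ord1 !coefE -!/(upd2 _ _ _ _ _) !cnt_upd2 // !sgn_upd2 //.
have -> : lift ord0 ord0 = 1 :> 'I_2 by exact: val_inj.
by move: ut; case: (up s); case: (up t) => //= _; ring.
Qed.

Lemma ex_cnt k : (k <= #|I|)%N -> exists w, cnt w = k.
Proof.
(* The first k slots must have bit 1; in a lower slot bit 1 means index 0. *)
move=> hk; exists [ffun s => if (enum_rank s < k)%N (+) ~~ up s then 1 else 0].
rewrite /cnt (eq_bigr (fun s => (enum_rank s < k)%N : nat)) => [|s _].
  rewrite (reindex_onto (@enum_val I I) (@enum_rank I)) /= => [|s _];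
    last exact: enum_rankK.
  rewrite (eq_bigl xpredT) => [|i]; last by rewrite enum_valK eqxx.
  under eq_bigr => i _ do rewrite enum_valK.
  rewrite -big_mkcond /= -(big_ord_widen _ (fun=> 1%N)) //.
  by rewrite sum1_card card_ord.
by rewrite /bit ffunE; case: (_ < _)%N; case: (up s).
Qed.

Lemma dim_traceless2 (W : {vspace tensor}) :
  (forall T, T \in W <-> traceless up T) -> \dim W = #|I|.+1.
Proof.
move=> WP.
have -> : W = limg (linfun binary).
  apply/vspaceP => T; apply/idP/memv_imgP => [/WP hT|[v _ ->]]; last first.
    by rewrite lfunE; apply/WP/traceless_binary.
  have [f hf] : exists f : nat -> idx, forall k, (k <= #|I|)%N -> cnt (f k) = k.
    have /choice[f hf] : forall k, exists w, (k <= #|I|)%N -> cnt w = k.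
      move=> k; case: (leqP k #|I|) => [/ex_cnt[w <-]|]; first by exists w.
      by exists [ffun=> 0].
    by exists f.
  (* By [traceless_cnt] one multi-index [f k] for each count k determines T. *)
  exists (\row_k (sgn (f k) * coef T (f k))); first exact: memvf.
  rewrite lfunE; apply: tensorP => w; rewrite coefE mxE inordK ?ltnS ?cnt_le //.
  rewrite -[coef T w]mul1r -(sgn2 w) -mulrA; congr (_ * _).
  by apply: traceless_cnt => //; rewrite hf ?cnt_le.
rewrite limg_dim_eq ?dimvf //=.
  by rewrite /dim /= mul1n.
apply/eqP; rewrite -subv0; apply/subvP => v; rewrite memv_cap => /andP[_].
rewrite memv_ker lfunE /= memv0 => /eqP v0; apply/eqP/rowP => k; rewrite mxE.
have [w wk] : exists w, cnt w = k by apply: ex_cnt; rewrite -ltnS.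
have := congr1 (fun T => coef T w) v0; rewrite coef0 coefE wk inord_val.
by move/(congr1 (fun x => sgn w * x)); rewrite mulrA sgn2 mul1r mulr0.
Qed.

End BinaryForms.

(** * Contractions and the decomposition of symmetric tensors *)

Section Contractions.
Variables (F : numFieldType) (n : nat).

(** The suffix is the number of slots, upper slots first: types (0,1), (1,2) and (2,3). *)
Definition up1 : pred 'I_1 := pred0.
Definition up3 : pred 'I_3 := fun s => (s < 1)%N.
Definition up5 : pred 'I_5 := fun s => (s < 2)%N.

Local Notation o1 k := (@Ordinal 1 k isT).
Local Notation o3 k := (@Ordinal 3 k isT).
Local Notation o5 k := (@Ordinal 5 k isT).

Definition idx1 i : {ffun 'I_1 -> 'I_n} := [ffun s : 'I_1 => i].
Definition idx3 a i j : {ffun 'I_3 -> 'I_n} := [ffun s : 'I_3 => nth a [:: a; i; j] s].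
Definition idx5 a b i j k : {ffun 'I_5 -> 'I_n} :=
  [ffun s : 'I_5 => nth a [:: a; b; i; j; k] s].

Lemma idx1_eta (w : {ffun 'I_1 -> 'I_n}) : w = idx1 (w (o1 0)).
Proof. by apply/ffunP => -[[|//] ?]; rewrite !ffunE; congr (w _); exact: val_inj. Qed.
Lemma idx3_eta (w : {ffun 'I_3 -> 'I_n}) : w = idx3 (w (o3 0)) (w (o3 1)) (w (o3 2)).
Proof.
by apply/ffunP => -[[|[|[|//]]] ?]; rewrite !ffunE; congr (w _); exact: val_inj.
Qed.
Lemma idx5_eta (w : {ffun 'I_5 -> 'I_n}) : w = idx5 (w (o5 0)) (w (o5 1)) (w (o5 2)) (w
  (o5 3)) (w (o5 4)).
Proof.
by apply/ffunP => -[[|[|[|[|[|//]]]]] ?]; rewrite !ffunE; congr (w _); exact: val_inj.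
Qed.

Lemma upd1 i c : upd (idx1 i) (o1 0) c = idx1 c.
Proof. by apply/ffunP => -[[|//] ?]; rewrite !ffunE. Qed.
Lemma upd3 a i j c :
  (upd (idx3 a i j) (o3 0) c = idx3 c i j) *
  (upd (idx3 a i j) (o3 1) c = idx3 a c j) *
  (upd (idx3 a i j) (o3 2) c = idx3 a i c).
Proof. by do !split; apply/ffunP => -[[|[|[|//]]] ?]; rewrite !ffunE. Qed.
Lemma upd5 a b i j k c :
  (upd (idx5 a b i j k) (o5 0) c = idx5 c b i j k) *
  (upd (idx5 a b i j k) (o5 1) c = idx5 a c i j k) *
  (upd (idx5 a b i j k) (o5 2) c = idx5 a b c j k) *
  (upd (idx5 a b i j k) (o5 3) c = idx5 a b i c k) *
  (upd (idx5 a b i j k) (o5 4) c = idx5 a b i j c).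
Proof. by do !split; apply/ffunP => -[[|[|[|[|[|//]]]]] ?]; rewrite !ffunE. Qed.

Local Notation tensor1 := (tensor F n 'I_1).
Local Notation tensor3 := (tensor F n 'I_3).
Local Notation tensor5 := (tensor F n 'I_5).
Implicit Types (l : tensor1) (t : tensor3) (T : tensor5) (B : 'M[F]_n).

Definition mk1 (f : 'I_n -> F) : tensor1 := mkt (fun w => f (w (o1 0))).
Definition mk3 (f : 'I_n -> 'I_n -> 'I_n -> F) : tensor3 :=
  mkt (fun w => f (w (o3 0)) (w (o3 1)) (w (o3 2))).
Definition mk5 (f : 'I_n -> 'I_n -> 'I_n -> 'I_n -> 'I_n -> F) : tensor5 :=
  mkt (fun w => f (w (o5 0)) (w (o5 1)) (w (o5 2)) (w (o5 3)) (w (o5 4))).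

Lemma coef_mk1 f i : coef (mk1 f) (idx1 i) = f i.
Proof. by rewrite coefE !ffunE. Qed.
Lemma coef_mk3 f a i j : coef (mk3 f) (idx3 a i j) = f a i j.
Proof. by rewrite coefE !ffunE. Qed.
Lemma coef_mk5 f a b i j k : coef (mk5 f) (idx5 a b i j k) = f a b i j k.
Proof. by rewrite coefE !ffunE. Qed.

Lemma tensor1P l l' : (forall i, coef l (idx1 i) = coef l' (idx1 i)) -> l = l'.
Proof. by move=> h; apply: tensorP => w; rewrite (idx1_eta w). Qed.
Lemma tensor3P t t' :
  (forall a i j, coef t (idx3 a i j) = coef t' (idx3 a i j)) -> t = t'.
Proof. by move=> h; apply: tensorP => w; rewrite (idx3_eta w). Qed.
Lemma tensor5P T T' :
  (forall a b i j k, coef T (idx5 a b i j k) = coef T' (idx5 a b i j k)) -> T = T'.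
Proof. by move=> h; apply: tensorP => w; rewrite (idx5_eta w). Qed.

Lemma ord3 (s : 'I_3) : s = o3 0 \/ s = o3 1 \/ s = o3 2.
Proof. by case: s => [[|[|[|//]]] ?]; [left|right; left|do 2!right]; exact: val_inj. Qed.
Lemma ord5 (s : 'I_5) : s = o5 0 \/ s = o5 1 \/ s = o5 2 \/ s = o5 3 \/ s = o5 4.
Proof.
by case: s => [[|[|[|[|[|//]]]]] ?]; [left|right; left|do 2!right; left|
  do 3!right; left|do 4!right]; exact: val_inj.
Qed.

Lemma smx_up (I : finType) (up : pred I) s B (f : 'I_n -> F) a : up s ->
  \sum_c smx up s B a c * f c = \sum_c B a c * f c.
Proof. by rewrite /smx => ->. Qed.

Lemma smx_down (I : finType) (up : pred I) s B (f : 'I_n -> F) i : ~~ up s ->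
  \sum_c smx up s B i c * f c = - \sum_c B c i * f c.
Proof.
rewrite /smx => /negbTE ->; rewrite -sumrN.
by apply: eq_bigr => c _; rewrite !mxE mulNr.
Qed.

Lemma coef_tact1 B l i :
  coef (tact up1 B l) (idx1 i) = - \sum_c B c i * coef l (idx1 c).
Proof.
rewrite coef_tact (bigD1 (o1 0)) // big_pred0 => [|[[|//] ?]//].
rewrite smx_down // !ffunE /= addr0; congr (- _).
by apply: eq_bigr => c _; rewrite upd1.
Qed.

Lemma coef_tact3 B t a i j : coef (tact up3 B t) (idx3 a i j) =
  \sum_c B a c * coef t (idx3 c i j) - \sum_c B c i * coef t (idx3 a c j)
  - \sum_c B c j * coef t (idx3 a i c).
Proof.
rewrite coef_tact (bigD1 (o3 0)) // (bigD1 (o3 1)) // (bigD1 (o3 2)) //.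
rewrite big_pred0 => [|[[|[|[|//]]] ?]//].
rewrite smx_up // !smx_down // !ffunE /= addr0 addrA.
do 2?congr (_ - _); by [congr (- _); apply: eq_bigr => c _;
  rewrite upd3 | apply: eq_bigr => c _; rewrite upd3].
Qed.

Lemma coef_tact5 B T a b i j k : coef (tact up5 B T) (idx5 a b i j k) =
  \sum_c B a c * coef T (idx5 c b i j k) + \sum_c B b c * coef T (idx5 a c i j k)
  - \sum_c B c i * coef T (idx5 a b c j k) - \sum_c B c j * coef T (idx5 a b i c k)
  - \sum_c B c k * coef T (idx5 a b i j c).
Proof.
rewrite coef_tact (bigD1 (o5 0)) // (bigD1 (o5 1)) // (bigD1 (o5 2)) //.
rewrite (bigD1 (o5 3)) // (bigD1 (o5 4)) // big_pred0 => [|[[|[|[|[|[|//]]]]] ?]//].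
rewrite 2?smx_up // !smx_down // !ffunE /= addr0 !addrA.
by congr (_ + _ - _ - _ - _); apply: eq_bigr => c _; rewrite upd5.
Qed.

Definition sym3 t := forall a i j, coef t (idx3 a j i) = coef t (idx3 a i j).
Definition sym5 T :=
  [/\ forall a b i j k, coef T (idx5 b a i j k) = coef T (idx5 a b i j k),
      forall a b i j k, coef T (idx5 a b j i k) = coef T (idx5 a b i j k)
    & forall a b i j k, coef T (idx5 a b i k j) = coef T (idx5 a b i j k)].

Lemma sum_deltaC (a : 'I_n) (f : 'I_n -> F) : \sum_i (i == a)%:R * f i = f a.
Proof. by under eq_bigr => i _ do rewrite eq_sym; exact: sum_delta. Qed.

Lemma sum_deltal f g (i : 'I_n) : \sum_c f c * ((c == i)%:R * g c) = f i * g i :> F.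
Proof.
rewrite -[RHS](sum_delta i (fun c => f c * g c)); apply: eq_bigr => c _.
by rewrite eq_sym mulrCA.
Qed.

Lemma sum_deltar f g (i : 'I_n) : \sum_c f c * ((i == c)%:R * g c) = f i * g i :> F.
Proof.
by rewrite -[RHS](sum_delta i (fun c => f c * g c)); apply: eq_bigr => c _;
  rewrite mulrCA.
Qed.

Lemma sum_scale f g (x : F) : \sum_(c < n) f c * (x * g c) = x * \sum_c f c * g c.
Proof. by rewrite mulr_sumr; apply: eq_bigr => c _; rewrite mulrCA. Qed.

Lemma sum_distr2 (f g1 g2 : 'I_n -> F) : \sum_c f c * (g1 c + g2 c) =
  \sum_c f c * g1 c + \sum_c f c * g2 c.
Proof. by rewrite -big_split; apply: eq_bigr => c _; rewrite mulrDr. Qed.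

(** A single contraction suffices: on tensors with [sym3] or [sym5] every other contraction equals
    one of this form. *)
Definition tr3 t : tensor1 := mk1 (fun j => \sum_c coef t (idx3 c c j)).
Definition tr5 T : tensor3 := mk3 (fun b j k => \sum_c coef T (idx5 c b c j k)).

(* Multiplication by the invariant tensor of type (1,1), symmetrized. *)
Definition ins1 l : tensor3 := mk3 (fun b j k =>
  (b == j)%:R * coef l (idx1 k) + (b == k)%:R * coef l (idx1 j)).
Definition ins3 t : tensor5 := mk5 (fun a b i j k =>
  (a == i)%:R * coef t (idx3 b j k) + (a == j)%:R * coef t (idx3 b i k) +
  (a == k)%:R * coef t (idx3 b i j) + (b == i)%:R * coef t (idx3 a j k) +
  (b == j)%:R * coef t (idx3 a i k) + (b == k)%:R * coef t (idx3 a i j)).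

Lemma tr3_is_linear : linear tr3.
Proof.
move=> k x y; apply: tensor1P => i; rewrite coefD coefZ !coef_mk1 mulr_sumr -big_split.
by apply: eq_bigr => c _; rewrite coefD coefZ.
Qed.
HB.instance Definition _ := GRing.isLinear.Build F tensor3 tensor1 *:%R tr3 tr3_is_linear.

Lemma tr5_is_linear : linear tr5.
Proof.
move=> k x y; apply: tensor3P => a i j;
  rewrite coefD coefZ !coef_mk3 mulr_sumr -big_split.
by apply: eq_bigr => c _; rewrite coefD coefZ.
Qed.
HB.instance Definition _ := GRing.isLinear.Build F tensor5 tensor3 *:%R tr5 tr5_is_linear.

Lemma ins1_is_linear : linear ins1.
Proof. by move=> k x y; apply: tensor3P => *; rewrite !(coefD, coefZ, coef_mk3);
  ring. Qed.
HB.instance Definition _ := GRing.isLinear.Build F tensor1 tensor3 *:%R ins1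
  ins1_is_linear.

Lemma ins3_is_linear : linear ins3.
Proof. by move=> k x y; apply: tensor5P => *; rewrite !(coefD, coefZ, coef_mk5);
  ring. Qed.
HB.instance Definition _ := GRing.isLinear.Build F tensor3 tensor5 *:%R ins3
  ins3_is_linear.

Lemma sym_ins1 l : sym3 (ins1 l).
Proof. by move=> a i j; rewrite !coef_mk3 addrC. Qed.

Lemma sym_ins3 t : sym3 t -> sym5 (ins3 t).
Proof.
move=> st; split=> a b i j k; rewrite !coef_mk5.
- ring.
- by rewrite (st a i j) (st b i j); ring.
- by rewrite (st a j k) (st b j k); ring.
Qed.

Lemma sym_tr5 T : sym5 T -> sym3 (tr5 T).
Proof. by case=> _ _ s a i j; rewrite !coef_mk3; apply: eq_bigr => c _; rewrite s. Qed.

Lemma tr3_ins1 l : tr3 (ins1 l) = (n%:R + 1) *: l.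
Proof.
apply: tensor1P => j; rewrite coef_mk1 coefZ.
under eq_bigr => c _ do rewrite coef_mk3 eqxx mul1r.
by rewrite big_split /= sum_deltaC sumr_const card_ord -mulr_natl; ring.
Qed.

(** Of the six terms, the one whose delta is fully contracted gives n t, three give t by
    substitution, and the last two contract t itself and assemble into [ins1 (tr3 t)]. *)
Lemma tr5_ins3 t : sym3 t -> tr5 (ins3 t) = (n%:R + 3) *: t + ins1 (tr3 t).
Proof.
move=> st; apply: tensor3P => b j k; rewrite coef_mk3 coefD coefZ coef_mk3 !coef_mk1.
under eq_bigr => c _ do rewrite coef_mk5 eqxx mul1r.
rewrite !big_split /= !sum_deltaC sum_delta -!mulr_sumr sumr_const card_ord.
by rewrite -[_ *+ n]mulr_natl (st b j k); ring.
Qed.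

Lemma tact_tr3 B t : tr3 (tact up3 B t) = tact up1 B (tr3 t).
Proof.
apply: tensor1P => j; rewrite coef_tact1 !coef_mk1.
under eq_bigr => c _ do rewrite coef_tact3.
rewrite !big_split /= [X in X + _ + _]exchange_big /= sumrN subrr add0r sumrN.
congr (- _); rewrite exchange_big; apply: eq_bigr => c _.
by rewrite coef_mk1 mulr_sumr.
Qed.

Lemma tact_tr5 B T : tr5 (tact up5 B T) = tact up3 B (tr5 T).
Proof.
apply: tensor3P => b j k; rewrite coef_tact3 !coef_mk3.
under eq_bigr => c _ do rewrite coef_tact5.
rewrite !big_split /= [X in X + _ + _ + _ + _]exchange_big /= !sumrN.
rewrite [X in X - _ - _]addrAC subrr add0r.
congr (_ - _ - _); rewrite exchange_big; apply: eq_bigr => c _;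
  by rewrite coef_mk3 mulr_sumr.
Qed.

(** The tensor of type (1,1) is invariant: the terms with [B] on its upper and on its lower index
    cancel. *)
Lemma tact_ins1 B l : tact up3 B (ins1 l) = ins1 (tact up1 B l).
Proof.
apply: tensor3P => b j k; rewrite coef_tact3 coef_mk3 !coef_tact1.
under eq_bigr => c _ do rewrite coef_mk3.
under [X in _ - X - _]eq_bigr => c _ do rewrite coef_mk3.
under [X in _ - _ - X]eq_bigr => c _ do rewrite coef_mk3.
by rewrite !sum_distr2 !(sum_deltal, sum_deltar) !sum_scale; ring.
Qed.

Lemma tact_ins3 B t : tact up5 B (ins3 t) = ins3 (tact up3 B t).
Proof.
apply: tensor5P => a b i j k; rewrite coef_tact5 coef_mk5 !coef_tact3.
under [X in X + _ - _ - _ - _]eq_bigr => c _ do rewrite coef_mk5.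
under [X in _ + X - _ - _ - _]eq_bigr => c _ do rewrite coef_mk5.
under [X in _ - X - _ - _]eq_bigr => c _ do rewrite coef_mk5.
under [X in _ - _ - X - _]eq_bigr => c _ do rewrite coef_mk5.
under [X in _ - _ - _ - X]eq_bigr => c _ do rewrite coef_mk5.
by rewrite !sum_distr2 !(sum_deltal, sum_deltar) !sum_scale; ring.
Qed.

Lemma tr35_ins31 l : tr3 (tr5 (ins3 (ins1 l))) = ((2 * n%:R + 4) * (n%:R + 1)) *: l.
Proof.
rewrite tr5_ins3 ?tr3_ins1; last exact: sym_ins1.
rewrite linearD !linearZ /= tr3_ins1; apply: tensorP => w.
by rewrite !(coefD, coefZ); ring.
Qed.

Lemma traceless1 l : traceless up1 l.
Proof.
split=> -[[|//] p] [[|//] q] w //= _.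
by rewrite (_ : Ordinal q = Ordinal p) ?upd_id ?upd_id //; exact: val_inj.
Qed.

Lemma traceless3P t : traceless up3 t <-> sym3 t /\ tr3 t = 0.
Proof.
split=> [[st tt]|[st tt]].
  split=> [a i j|]; first by have := st (o3 1) (o3 2) (idx3 a i j) erefl;
    rewrite !ffunE /= !upd3.
  apply: tensor1P => j; rewrite coef0 coef_mk1.
  rewrite -[RHS](tt (o3 0) (o3 1) (idx3 j j j)) //.
  by apply: eq_bigr => c _; rewrite !upd3.
have {}tt j : \sum_c coef t (idx3 c c j) = 0.
  by have := congr1 (fun l => coef l (idx1 j)) tt; rewrite coef0 coef_mk1.
split=> s r w; rewrite (idx3_eta w); move: (w _) (w _) (w _) => j i a {w}.
  by case: (ord3 s) => [|[]] ->; case: (ord3 r) => [|[]] -> //= _;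
    rewrite !ffunE /= !upd3.
case: (ord3 s) => [|[]] ->; case: (ord3 r) => [|[]] -> //= _;
  [rewrite -[RHS](tt j)|rewrite -[RHS](tt i)|rewrite -[RHS](tt j)|rewrite -[RHS](tt i)];
  by apply: eq_bigr => c _; rewrite !upd3 ?(st c c i).
Qed.

(** [sym5] lists adjacent transpositions only; the remaining exchanges of lower slots are obtained
    by conjugating them, and all six contractions reduce to [tr5]. *)
Lemma traceless5P T : traceless up5 T <-> sym5 T /\ tr5 T = 0.
Proof.
split=> [[sT tT]|[[s1 s2 s3] tT]].
  split; first split=> a b i j k.
  - by have := sT (o5 0) (o5 1) (idx5 a b i j k) erefl; rewrite !ffunE /= !upd5.
  - by have := sT (o5 2) (o5 3) (idx5 a b i j k) erefl; rewrite !ffunE /= !upd5.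
  - by have := sT (o5 3) (o5 4) (idx5 a b i j k) erefl; rewrite !ffunE /= !upd5.
  apply: tensor3P => b j k; rewrite coef0 coef_mk3.
  rewrite -[RHS](tT (o5 0) (o5 2) (idx5 b b j j k)) //.
  by apply: eq_bigr => c _; rewrite !upd5.
have {}tT b j k : \sum_c coef T (idx5 c b c j k) = 0.
  by have := congr1 (fun t => coef t (idx3 b j k)) tT; rewrite coef0 coef_mk3.
split=> s r w; rewrite (idx5_eta w); move: (w _) (w _) (w _) (w _) (w _) => k j i b a {w}.
  case: (ord5 s) => [|[|[|[]]]] ->; case: (ord5 r) => [|[|[|[]]]] -> //= _;
    rewrite !ffunE /= !upd5 //.
  - by rewrite s2 s3 s2.
  - by rewrite s2 s3 s2.
have tT2 b' i' k' : \sum_c coef T (idx5 c b' i' c k') = 0.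
  by rewrite -[RHS](tT b' i' k'); apply: eq_bigr => c _; rewrite s2.
have tT3 b' i' j' : \sum_c coef T (idx5 c b' i' j' c) = 0.
  by rewrite -[RHS](tT2 b' i' j'); apply: eq_bigr => c _; rewrite s3.
have tT' a' (f g h : 'I_n -> 'I_n) : \sum_c coef T (idx5 a' c (f c) (g c) (h c)) =
    \sum_c coef T (idx5 c a' (f c) (g c) (h c)).
  by apply: eq_bigr => c _; rewrite s1.
case: (ord5 s) => [|[|[|[]]]] ->; case: (ord5 r) => [|[|[|[]]]] -> //= _;
  under eq_bigr => c _ do rewrite !upd5.
all: rewrite ?(tT' _ id (fun=> _) (fun=> _)) ?(tT' _ (fun=> _) id (fun=> _))
  ?(tT' _ (fun=> _) (fun=> _) id) //.
Qed.

Lemma symmetric_decomposition T : sym5 T ->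
  exists T0 t l, [/\ traceless up5 T0, traceless up3 t
    & T = T0 + ins3 t + ins3 (ins1 l)].
Proof.
move=> sT; set t := tr5 T; set l := tr3 t.
have n1 : n%:R + 1 != 0 :> F by rewrite natr1 pnatr_eq0.
have n2 : n%:R + 2 != 0 :> F by rewrite -natrD pnatr_eq0 addn2.
have n3 : n%:R + 3 != 0 :> F by rewrite -natrD pnatr_eq0 addn3.
have st : sym3 t by exact: sym_tr5.
pose t1 := t - (n%:R + 1)^-1 *: ins1 l.
have st1 : sym3 t1.
  by move=> a i j; rewrite !(coefD, coefN, coefZ) st (sym_ins1 l).
have tt1 : tr3 t1 = 0.
  by rewrite linearB linearZ /= tr3_ins1 scalerA mulVf // scale1r subrr.
(* [t1] is the traceless part of [tr5 T]. The factors invert [tr5] on the two inserted summands: n +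
   3 on [ins3 t2], and 2n + 4 on [ins3 (ins1 l2)], where the factor n + 1 comes from splitting off
   [t1]. *)
pose t2 := (n%:R + 3)^-1 *: t1.
pose l2 := ((n%:R + 1) * (2 * (n%:R + 2)))^-1 *: l.
exists (T - ins3 t2 - ins3 (ins1 l2)), t2, l2; split; last by rewrite addrAC !subrK.
  apply/traceless5P; split.
    have sI u : sym3 u -> sym5 (ins3 u) by exact: sym_ins3.
    have [a1 a2 a3] := sT.
    have [|b1 b2 b3] := sI t2; first by move=> *; rewrite !coefZ st1.
    have [|c1 c2 c3] := sI (ins1 l2); first exact: sym_ins1.
    by split=> *; rewrite !(coefD, coefN);
      [rewrite a1 b1 c1|rewrite a2 b2 c2|rewrite a3 b3 c3].
  have st2 : sym3 t2 by move=> *; rewrite !coefZ st1.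
  have tt2 : tr3 t2 = 0 by rewrite /t2 linearZ /= tt1; exact: scaler0.
  have e2 : tr5 (ins3 t2) = t1.
    by rewrite tr5_ins3 // tt2 linear0 addr0 scalerA divff // scale1r.
  have e3 : tr5 (ins3 (ins1 l2)) = (n%:R + 1)^-1 *: ins1 l.
    rewrite tr5_ins3 ?tr3_ins1; last exact: sym_ins1.
    have l2E : ins1 l2 = ((n%:R + 1) * (2 * (n%:R + 2)))^-1 *: ins1 l by rewrite linearZ.
    rewrite [ins1 (_ *: _)]linearZ /= l2E; apply: tensorP => w /=.
    by rewrite !(coefD, coefZ); field; rewrite n1 n2.
  by rewrite !linearB /= e2 e3 -/t /t1 subKr subrr.
by apply/traceless3P; split; [move=> *; rewrite !coefZ st1 | rewrite linearZ /= tt1;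
  exact: scaler0].
Qed.

End Contractions.

(** * Curvature identities *)

Section LfunSimpl.
Variables (K : fieldType) (U W : vectType K) (f : 'Hom(U, W)).
Lemma lfD x y : f (x + y) = f x + f y. Proof. exact: linearD. Qed.
Lemma lfN x : f (- x) = - f x. Proof. exact: linearN. Qed.
Lemma lfZ k x : f (k *: x) = k *: f x. Proof. exact: linearZ. Qed.
End LfunSimpl.
Definition lfE := (lfD, lfN, lfZ, add_lfunE, opp_lfunE, scale_lfunE).

Section CurvatureDerivatives.
Variables (R : realType) (V : vectType R) (g : {symmetric V}) (J : 'End(V)).
Hypothesis hJ : orthogonal_complex_structure g J.
Hypothesis g_inj : forall x y, (forall u, g x u = g y u) -> x = y.
Implicit Types (S : S_space V) (A : 'End(V)) (X Y Z W U : V).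

Lemma JJ X : J (J X) = - X. Proof. by case: hJ. Qed.
Lemma gJ X Y : g (J X) Y = - g X (J Y).
Proof. by case: hJ => _ /(_ (J X) Y) <-; rewrite JJ linearNl. Qed.
Lemma gC X Y : g X Y = g Y X. Proof. by rewrite hermC /= expr0 mul1r. Qed.

Lemma gD X Y Z : g (X + Y) Z = g X Z + g Y Z. Proof. exact: linearDl. Qed.
Lemma gN X Z : g (- X) Z = - g X Z. Proof. exact: linearNl. Qed.
Lemma gZ k X Z : g (k *: X) Z = k * g X Z. Proof. exact: linearZl_LR. Qed.
Lemma g0 Z : g 0 Z = 0. Proof. exact: linear0l. Qed.
Lemma gDr X Y Z : g Z (X + Y) = g Z X + g Z Y. Proof. exact: linearDr. Qed.
Lemma gNr X Z : g Z (- X) = - g Z X. Proof. exact: linearNr. Qed.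
Definition gE := (gD, gN, gZ, g0, gDr, gNr, gJ, JJ).

Lemma u_skew A X Y : u_algebra g J A -> g (A X) Y = - g (A Y) X.
Proof. by case=> /(_ X Y) /eqP; rewrite addr_eq0 => /eqP ->; rewrite gC. Qed.
Lemma u_J A X : u_algebra g J A -> A (J X) = J (A X).
Proof. by case=> _ /= h; rewrite -!comp_lfunE h. Qed.

(* The component of S_X(Y,Z)W that is complex linear in X, Y, W and antilinear
   in Z. *)
Definition holo S X Y W Z : V :=
  4^-1 *: (S X Y Z W - J (S X (J Y) Z W) - J (S (J X) Y Z W) - S (J X) (J Y) Z W).


(** Here and below a vector identity is tested against [g], which turns it into linear arithmetic
    over the reals. *)
Lemma holoJ1 S X Y W Z : holo S (J X) Y W Z = J (holo S X Y W Z).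
Proof.
apply: g_inj => U; rewrite /holo !JJ !(lfE, gE); lra.
Qed.

Lemma holoJ2 S X Y W Z : holo S X (J Y) W Z = J (holo S X Y W Z).
Proof.
apply: g_inj => U; rewrite /holo !JJ !(lfE, gE); lra.
Qed.

Variable S : S_space V.
Hypothesis hS : nabla_curvature_space (u_algebra g J) S.

Lemma S_alt X Y Z : S X Y Z = - S X Z Y.
Proof.
have [h _] := hS; have [alt _ _] := h X.
apply/eqP; rewrite -addr_eq0; have := alt (Y + Z).
by rewrite !lfE !alt ?add0r ?addr0 [S X Z Y + _]addrC => ->.
Qed.

Lemma S_u X Y Z : u_algebra g J (S X Y Z).
Proof. by have [h _] := hS; have [_ hu _] := h X; exact: hu. Qed.
Lemma S_bianchi1 X Y Z W : S X Y Z W + S X Z W Y + S X W Y Z = 0.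
Proof. by have [h _] := hS; have [_ _ hb] := h X; exact: hb. Qed.
Lemma S_bianchi2 X Y Z W : S X Y Z W + S Y Z X W + S Z X Y W = 0.
Proof.
have [_ h] := hS; have := congr1 (fun f : 'End(V) => f W) (h X Y Z).
by rewrite !add_lfunE zero_lfunE.
Qed.

Lemma S_J X Y Z W : S X Y Z (J W) = J (S X Y Z W).
Proof. by apply: u_J; exact: S_u. Qed.

Lemma gS_alt X Y Z W U : g (S X Y Z W) U = - g (S X Z Y W) U.
Proof. by rewrite S_alt opp_lfunE gN. Qed.
Lemma gS_skew X Y Z W U : g (S X Y Z W) U = - g (S X Y Z U) W.
Proof. by apply: u_skew; exact: S_u. Qed.
Lemma gS_bianchi1 X Y Z W U : g (S X Y Z W) U + g (S X Z W Y) U + g (S X W Y Z) U = 0.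
Proof. by rewrite -!gD S_bianchi1 g0. Qed.

(** The classical pair symmetry of a curvature tensor: combine the four first Bianchi identities
    obtained by cyclically shifting Y, Z, W, U. *)
Lemma S_pair X Y Z W U : g (S X Y Z W) U = g (S X W U Y) Z.
Proof.
have := gS_bianchi1 X Y Z W U; have := gS_bianchi1 X Z W U Y.
have := gS_bianchi1 X W U Y Z; have := gS_bianchi1 X U Y Z W.
have a := gS_alt X; have s := gS_skew X.
have := s Y Z W U; have := s Z W Y U; have := s W U Z Y; have := s U Y W Z.
have := a W Y Z U; have := s Y W Z U; have := a U Z W Y; have := s Z U W Y.
lra.
Qed.

(** Values in u(p,q) give J-invariance in the last two arguments; pair symmetry carries it to the
    first two. *)
Lemma S_JJ X Y Z : S X (J Y) (J Z) = S X Y Z.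
Proof.
apply/lfunP => W; apply: g_inj => U.
rewrite S_pair S_J [RHS]S_pair; rewrite !gE; lra.
Qed.

Lemma S_Jr X Y Z : S X Y (J Z) = - S X (J Y) Z.
Proof. by rewrite -(S_JJ X (J Y) Z) JJ !lfE opprK. Qed.

Lemma holoJ3 X Y W Z : holo S X Y (J W) Z = J (holo S X Y W Z).
Proof. by rewrite /holo !S_J; apply: g_inj => U; rewrite !gE; lra. Qed.

Lemma holoJ4 X Y W Z : holo S X Y W (J Z) = - J (holo S X Y W Z).
Proof.
rewrite /holo; apply: g_inj => U; rewrite !S_Jr !(lfE, gE); lra.
Qed.

(** Second Bianchi identity: the third terms, with Z as direction of differentiation, cancel because
    S_Z(X,Y) is J-invariant in X and Y. *)
Lemma holoC12 X Y W Z : holo S X Y W Z = holo S Y X W Z.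
Proof.
have b2 X1 X2 X3 W1 U : g (S X1 X2 X3 W1) U + g (S X2 X3 X1 W1) U + g (S X3 X1 X2 W1) U =
  0.
  by rewrite -!gD S_bianchi2 g0.
apply: g_inj => U; rewrite /holo !gE.
have a := gS_alt.
have := b2 X Y Z W U; have := b2 X (J Y) Z W (J U).
have := b2 (J X) Y Z W (J U); have := b2 (J X) (J Y) Z W U.
rewrite (a Y Z X) (a (J Y) Z X) (a Y Z (J X)) (a (J Y) Z (J X)).
rewrite S_JJ S_Jr !lfE gN; lra.
Qed.

Lemma S_symYW X Y W Z U : g (S X Y Z W) U + g (S X (J Y) Z W) (J U) =
  g (S X W Z Y) U + g (S X (J W) Z Y) (J U).
Proof.
have := gS_bianchi1 X Y Z W U; have := gS_bianchi1 X (J Y) Z W (J U).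
have := gS_bianchi1 X Y Z (J W) (J U).
have -> : S X (J W) Z = S X (J Z) W by rewrite S_alt S_Jr opprK.
rewrite !S_J !S_Jr !lfE !gE (gS_alt X W Z); lra.
Qed.

Lemma S_flip X Y W Z U : g (S X Y Z W) U + g (S X (J Y) Z W) (J U) =
  g (S X Z Y U) W + g (S X (J Z) Y U) (J W).
Proof.
have -> : S X (J Z) Y = S X (J Y) Z by rewrite S_alt S_Jr opprK.
rewrite (gS_skew X Y Z W U) (gS_skew X (J Y) Z W) S_J gS_alt !gE; lra.
Qed.

Lemma holoC23 X Y W Z : holo S X Y W Z = holo S X W Y Z.
Proof.
apply: g_inj => U; rewrite /holo !gE.
by have := S_symYW X Y W Z U; have := S_symYW (J X) Y W Z (J U); rewrite !gE; lra.
Qed.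

(** [S_flip] exchanges Y with Z and W with U, so it carries the symmetry in Y and W to one in Z and
    U. *)
Lemma holo_sym45 X Y W Z U : g (holo S X Y W Z) U = g (holo S X Y W U) Z.
Proof.
have sym X' U' Z' : g (S X' Y Z' W) U' + g (S X' (J Y) Z' W) (J U') =
    g (S X' Y U' W) Z' + g (S X' (J Y) U' W) (J Z').
  by rewrite S_flip S_symYW -S_flip.
rewrite /holo !gE; have := sym X U Z; have := sym (J X) (J U) Z.
rewrite !S_JJ !S_Jr !lfE !gE; lra.
Qed.

Lemma holo_inj0 : (forall X Y W Z, holo S X Y W Z = 0) -> S = 0.
Proof.
move=> h0.
(* Twice the component linear in Y, paired with U. Vanishing of [holo] makes it antilinear in X;
   [S_flip] behaves like a complex conjugation and makes it linear in X as well, so it is zero.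
   Alternating in Y and Z then recovers S. *)
pose P X Y W Z U := g (S X Y Z W) U + g (S X (J Y) Z W) (J U).
have PJ X Y W Z U : P (J X) Y W Z U = P X Y W Z (J U).
  have := congr1 (g^~ (J U)) (h0 X Y W Z); rewrite /holo /= !gE /P gE; lra.
have P1 X Y W Z U : P (J X) Y W Z U = 0.
  have e1 : P (J X) Y W Z U = P X Z U Y (J W).
    by rewrite /P S_flip -/(P _ _ _ _ _) PJ.
  have e2 : P (J X) Y W Z U = - P X Z U Y (J W).
    rewrite PJ /P S_flip S_J [S _ _ _ (J U)]S_J !gE; lra.
  lra.
have P0 X Y W Z U : P X Y W Z U = 0 by rewrite -[X]opprK -JJ; exact: P1.
apply/lfunP => X; apply/lfunP => Y; apply/lfunP => Z; apply/lfunP => W.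
apply: g_inj => U; rewrite !zero_lfunE g0.
have := P0 X Y W Z U; have := P0 X Z W Y U; rewrite /P.
have -> : S X (J Z) Y = S X (J Y) Z by rewrite S_alt S_Jr opprK.
rewrite (gS_alt X Z); lra.
Qed.

Lemma S_act_nabla A : u_algebra g J A -> nabla_curvature_space (u_algebra g J) (S_act A
  S).
Proof.
move=> uA; have AJ := u_J _ uA; have Ag x y : g (A x) y = - g x (A y).
  by rewrite (u_skew _ _ uA) gC.
split=> [X|X Y Z]; last first.
  apply/lfunP => W; apply: g_inj => U; rewrite !lfE zero_lfunE !S_actE !gE !Ag.
  have b2 X1 X2 X3 W1 U1 : g (S X1 X2 X3 W1) U1 + g (S X2 X3 X1 W1) U1 + g (S X3 X1 X2
    W1) U1 = 0.
    by rewrite -!gD S_bianchi2 g0.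
  have := b2 X Y Z W (A U); have := b2 X Y Z (A W) U; have := b2 (A X) Y Z W U.
  have := b2 X (A Y) Z W U; have := b2 X Y (A Z) W U; lra.
split=> [Y|Y Z|Y Z W].
- apply/lfunP => W; apply: g_inj => U; rewrite !zero_lfunE S_actE !gE.
  have alt X1 W1 U1 : g (S X1 Y Y W1) U1 = 0 by have := gS_alt X1 Y Y W1 U1; lra.
  by rewrite !Ag !alt (gS_alt X Y (A Y)); lra.
- split.
    move=> W U; rewrite !S_actE [g W _]gC !gE !Ag.
    have := gS_skew X Y Z W (A U); have := gS_skew X Y Z (A W) U.
    have := gS_skew X Y (A Z) W U; have := gS_skew X (A Y) Z W U.
    have := gS_skew (A X) Y Z W U; lra.
  apply/lfunP => W; rewrite !comp_lfunE !S_actE !AJ !S_J.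
  by apply: g_inj => U; rewrite AJ !(lfE, gE); lra.
- apply: g_inj => U; rewrite !S_actE !gE !Ag.
  have := gS_bianchi1 X Y Z W (A U); have := gS_bianchi1 (A X) Y Z W U.
  have := gS_bianchi1 X (A Y) Z W U; have := gS_bianchi1 X Y (A Z) W U.
  have := gS_bianchi1 X Y Z (A W) U; lra.
Qed.

End CurvatureDerivatives.

(** * Coordinates *)

Lemma complexP (R : rcfType) (x y : R[i]) :
  complex.Re x = complex.Re y -> complex.Im x = complex.Im y -> x = y.
Proof. by move=> hr hi; apply/eqP; rewrite eq_complex hr hi !eqxx. Qed.

Section Coordinates.
Variables (R : realType) (n : nat) (V : vectType R) (g : {symmetric V}) (J : 'End(V)).
Local Notation C := (R[i]).
Variables (phi : {linear V -> 'cV[C]_n | real_complex R \; *:%R}) (psi : 'cV[C]_n -> V).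
(* [z] is the h-dual of the basis [basis_vec] below, see [zP]. *)
Variable z : 'I_n -> V.
Hypothesis hJ : orthogonal_complex_structure g J.
Hypotheses (phiK : cancel phi psi) (psiK : cancel psi phi).
Hypothesis phiJ : forall v, phi (J v) = 'i%C *: phi v.

Definition herm (x y : V) : C := (g x y +i* g x (J y))%C.
Hypothesis zP : forall v b, phi v b 0 = herm v (z b).

Implicit Types (S : S_space V) (A : 'End(V)) (X Y Z W U v : V).
Local Notation "k %:C" := (real_complex R k).
Local Notation gE := (gE hJ).

Lemma hermP k x y v : herm (k *: x + y) v = k%:C * herm x v + herm y v.
Proof. by apply: complexP; rewrite /herm !gE /=; ring. Qed.

Lemma hermPr k x y v : herm v (k *: x + y) = k%:C * herm v x + herm v y.
Proof.
by apply: complexP; rewrite /herm !lfE !(gC g v) !gE /=; ring.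
Qed.

Lemma hermJ x y : herm (J x) y = 'i%C * herm x y.
Proof. by apply: complexP; rewrite /herm !gE /=; ring. Qed.

Lemma hermJr x y : herm x (J y) = - 'i%C * herm x y.
Proof. by apply: complexP; rewrite /herm !gE /=; ring. Qed.

Lemma hermC x y : herm y x = conjc (herm x y).
Proof.
rewrite /herm /=; apply/eqP; rewrite eq_complex /= gC eqxx /=.
by rewrite (gC g y) gJ // eqxx.
Qed.

Lemma phiP k x y a : phi (k *: x + y) a 0 = k%:C * phi x a 0 + phi y a 0.
Proof. by rewrite linearP !mxE. Qed.

Lemma phi_inj x y : (forall a, phi x a 0 = phi y a 0) -> x = y.
Proof.
by move=> h; apply: (can_inj phiK); apply/matrixP => i j; rewrite ord1 h.
Qed.

Lemma g_nondeg x y : (forall u, g x u = g y u) -> x = y.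
Proof. by move=> h; apply: phi_inj => a; rewrite !zP /herm !h. Qed.

Lemma herm_inj x y : (forall u, herm u x = herm u y) -> x = y.
Proof.
move=> h; apply: g_nondeg => u; rewrite gC [RHS]gC.
by have := congr1 (@complex.Re R) (h u).
Qed.

(** V is only a real space, so complex linearity is real linearity together with compatibility with
    [J]. *)
Definition clinear (L : V -> C) : Prop :=
  (forall k x y, L (k *: x + y) = k%:C * L x + L y) /\ forall x, L (J x) = 'i%C * L x.
Definition antilinear (L : V -> C) : Prop :=
  (forall k x y, L (k *: x + y) = k%:C * L x + L y) /\ forall x, L (J x) = - 'i%C * L x.

Lemma rlinear0 (L : V -> C) :
  (forall k x y, L (k *: x + y) = k%:C * L x + L y) -> L 0 = 0.
Proof.
move=> LP; have := LP 1 0 0; rewrite scaler0 addr0 rmorph1 mul1r.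
by move/eqP; rewrite -subr_eq subrr eq_sym => /eqP.
Qed.

Lemma rlinearD (L : V -> C) x y :
  (forall k x y, L (k *: x + y) = k%:C * L x + L y) -> L (x + y) = L x + L y.
Proof. by move=> LP; rewrite -[x]scale1r LP rmorph1 mul1r scale1r. Qed.

Lemma rlinearZ (L : V -> C) k x :
  (forall k x y, L (k *: x + y) = k%:C * L x + L y) -> L (k *: x) = k%:C * L x.
Proof. by move=> LP; rewrite -[_ *: _]addr0 LP rlinear0 // addr0. Qed.

Lemma real_sum (L : V -> C) (f : 'I_n -> V) :
  (forall k x y, L (k *: x + y) = k%:C * L x + L y) ->
  L (\sum_i f i) = \sum_i L (f i).
Proof.
by move=> LP; apply: (big_morph L) => [x y|]; [exact: rlinearD | exact: rlinear0].
Qed.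

Definition basis_vec i : V := psi (delta_mx i 0).
Local Notation e := basis_vec.

Lemma phi_e i j : phi (e i) j 0 = (j == i)%:R.
Proof. by rewrite psiK mxE eqxx andbT. Qed.

Lemma phi_expand v :
  v = \sum_c (complex.Re (phi v c 0) *: e c + complex.Im (phi v c 0) *: J (e c)).
Proof.
apply: phi_inj => a.
rewrite (real_sum (L := fun v => phi v a 0)); last by move=> *; exact: phiP.
rewrite (bigD1 a) //= big1 => [|c /negbTE ca].
  rewrite addr0 phiP -[complex.Im _ *: _]addr0 phiP linear0 phiJ !mxE phi_e eqxx.
  by rewrite mulr1 addr0 mulr1 mulrC -complexE.
rewrite phiP -[complex.Im _ *: _]addr0 phiP linear0 phiJ !mxE phi_e eq_sym ca.
by rewrite !mulr0 !addr0.
Qed.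

Lemma clinearE L v : clinear L -> L v = \sum_c phi v c 0 * L (e c).
Proof.
move=> [LP LJ]; rewrite {1}[v]phi_expand real_sum //; apply: eq_bigr => c _.
rewrite LP rlinearZ // LJ [in RHS](complexE (phi v c 0)); ring.
Qed.

Lemma herm_clinear v : clinear (herm^~ v).
Proof. by split=> [k x y|x]; [exact: hermP | exact: hermJ]. Qed.

Lemma phi_clinear a : clinear (fun v => phi v a 0).
Proof. by split=> [k x y|x]; [exact: phiP | rewrite phiJ mxE]. Qed.

Lemma herm_antilinear v : antilinear (herm v).
Proof. by split=> [k x y|x]; [exact: hermPr | exact: hermJr]. Qed.

(** The coefficient of [z b] is the conjugate of [herm (e b) v], as [herm] is antilinear in its
    second argument; hence the minus sign. *)
Lemma herm_expand v : v =
  \sum_b (complex.Re (herm (e b) v) *: z b - complex.Im (herm (e b) v) *: J (z b)).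
Proof.
apply: herm_inj => u; have hP : forall k x y, _ := (herm_antilinear u).1.
rewrite real_sum // (clinearE _ (herm_clinear v)); apply: eq_bigr => b _.
rewrite -scaleNr hP rlinearZ // (herm_antilinear u).2 -zP rmorphN.
by rewrite [in LHS](complexE (herm _ _)) /=; ring.
Qed.

Lemma antilinearE L v : antilinear L -> L v = \sum_b herm (e b) v * L (z b).
Proof.
move=> [LP LJ]; rewrite {1}[v]herm_expand real_sum //; apply: eq_bigr => c _.
rewrite -scaleNr LP rlinearZ // LJ [in RHS](complexE (herm (e c) v)) rmorphN /=; ring.
Qed.

Lemma u_herm A X Y : u_algebra g J A -> herm (A X) Y = - herm X (A Y).
Proof.
move=> uA; rewrite /herm -(u_J _ uA) (u_skew _ _ uA) (u_skew X (J Y) uA) (gC g (A Y)) (gC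
  g (A (J Y))).
by apply: complexP.
Qed.

Local Notation nabla S := (nabla_curvature_space (u_algebra g J) S).
Local Notation holo := (holo J).

(** Inserting the dual vector [z b] in the antilinear argument is what raises it to the upper index
    b. *)
Definition Psi S : tensor C n 'I_5 :=
  mk5 (fun a b i j k => phi (holo S (e i) (e j) (e k) (z b)) a 0).

Lemma holoP1 S k X X' Y W Z : holo S (k *: X + X') Y W Z = k *: holo S X Y W Z + holo S
  X' Y W Z.
Proof. apply: g_nondeg => U; rewrite /holo !(lfE, gE); lra. Qed.
Lemma holoP2 S k X Y Y' W Z : holo S X (k *: Y + Y') W Z = k *: holo S X Y W Z + holo S X
  Y' W Z.
Proof. apply: g_nondeg => U; rewrite /holo !(lfE, gE); lra. Qed.
Lemma holoP3 S k X Y W W' Z : holo S X Y (k *: W + W') Z = k *: holo S X Y W Z + holo S X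
  Y W' Z.
Proof. apply: g_nondeg => U; rewrite /holo !(lfE, gE); lra. Qed.
Lemma holoP4 S k X Y W Z Z' : holo S X Y W (k *: Z + Z') = k *: holo S X Y W Z + holo S X
  Y W Z'.
Proof. apply: g_nondeg => U; rewrite /holo !(lfE, gE); lra. Qed.

Lemma holo_clin1 S a Y W Z : clinear (fun X => phi (holo S X Y W Z) a 0).
Proof.
split=> [k x y|x]; first by rewrite holoP1 phiP.
by rewrite (holoJ1 hJ g_nondeg) phiJ mxE.
Qed.
Lemma holo_clin2 S a X W Z : clinear (fun Y => phi (holo S X Y W Z) a 0).
Proof.
split=> [k x y|x]; first by rewrite holoP2 phiP.
by rewrite (holoJ2 hJ g_nondeg) phiJ mxE.
Qed.
Lemma holo_clin3 S a X Y Z : nabla S -> clinear (fun W => phi (holo S X Y W Z) a 0).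
Proof.
move=> hS; split=> [k x y|x]; first by rewrite holoP3 phiP.
by rewrite (holoJ3 hJ g_nondeg hS) phiJ mxE.
Qed.
Lemma holo_anti4 S a X Y W : nabla S -> antilinear (fun Z => phi (holo S X Y W Z) a 0).
Proof.
move=> hS; split=> [k x y|x]; first by rewrite holoP4 phiP.
by rewrite (holoJ4 hJ g_nondeg hS) linearN phiJ !mxE mulNr.
Qed.

Lemma Psi_is_rlinear k S1 S2 : Psi (k *: S1 + S2) = k%:C *: Psi S1 + Psi S2.
Proof.
apply: tensor5P => *; rewrite coefD coefZ !coef_mk5 -phiP; congr (phi _ _ _).
apply: g_nondeg => U; rewrite /holo !(lfE, gE); lra.
Qed.

Lemma herm_holo S X Y W Z U : nabla S -> herm (holo S X Y W Z) U = herm (holo S X Y W U)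
  Z.
Proof.
move=> hS; rewrite /herm (holo_sym45 hJ g_nondeg hS) (holo_sym45 hJ g_nondeg hS _ _ _ _
  (J U)).
by rewrite (holoJ4 hJ g_nondeg hS) gN gJ // opprK.
Qed.

Lemma Psi_sym S : nabla S -> sym5 (Psi S).
Proof.
move=> hS; split=> a b i j k; rewrite !coef_mk5.
- by rewrite !zP herm_holo.
- by rewrite (holoC12 hJ g_nondeg hS).
- by rewrite (holoC23 hJ g_nondeg hS).
Qed.

Lemma Psi_inj0 S : nabla S -> Psi S = 0 -> S = 0.
Proof.
move=> hS P0; apply: (holo_inj0 hJ g_nondeg hS) => X Y W Z.
apply: phi_inj => a; rewrite linear0 mxE.
rewrite (clinearE X (holo_clin1 S a Y W Z)) big1 // => i _.
rewrite (clinearE Y (holo_clin2 S a _ W Z)) big1 ?mulr0 // => j _.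
rewrite (clinearE W (holo_clin3 a _ _ Z hS)) big1 ?mulr0 // => k _.
rewrite (antilinearE Z (holo_anti4 a _ _ _ hS)) big1 ?mulr0 // => b _.
have := congr1 (fun T => coef T (idx5 a b i j k)) P0.
by rewrite coef0 coef_mk5 => ->; rewrite mulr0.
Qed.

Lemma Psi_act S A : nabla S -> u_algebra g J A ->
  Psi (S_act A S) = tact up5 (gl_mx phi psi A) (Psi S).
Proof.
move=> hS uA; have AJ := u_J _ uA.
apply: tensor5P => a b i j k; rewrite coef_tact5 !coef_mk5.
have -> X Y W Z : holo (S_act A S) X Y W Z = A (holo S X Y W Z) - holo S X Y W (A Z) -
    holo S (A X) Y W Z - holo S X (A Y) W Z - holo S X Y (A W) Z.
  by apply: g_nondeg => U; rewrite /holo !S_actE !AJ !(lfE, gE, AJ); lra.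
rewrite !linearB !mxE.
have phiA_clin : clinear (fun v => phi (A v) a 0).
  by split=> [c x y|x]; [rewrite linearP phiP | rewrite AJ phiJ mxE].
rewrite (clinearE _ phiA_clin).
rewrite (antilinearE (A (z b)) (holo_anti4 a _ _ _ hS)).
rewrite (clinearE (A (e i)) (holo_clin1 S a _ _ _)).
rewrite (clinearE (A (e j)) (holo_clin2 S a _ _ _)).
rewrite (clinearE (A (e k)) (holo_clin3 a _ _ _ hS)).
rewrite -sumrN; congr (_ + _ - _ - _ - _); apply: eq_bigr => c _;
  rewrite coef_mk5 mxE // mulrC //.
(* Skewness for h turns minus the action on the antilinear argument into the standard action on the
   upper index b. *)
by have := u_herm (e c) (z b) uA; rewrite -zP [psi _]/(e c) => ->; rewrite mulNr mulrC.
Qed.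

End Coordinates.

(** * Construction of curvature derivatives from tensors *)

Lemma linfunP (K : fieldType) (U W : vectType K) (f : U -> W) x :
  linear f -> linfun f x = f x.
Proof.
move=> linf.
pose fM := GRing.isLinear.Build K U W *:%R f linf.
pose fL : {linear U -> W} := HB.pack f fM.
exact: (lfunE fL).
Qed.

Section Multilinear.
Variables (R : realType) (V : vectType R).

Definition mkS (f : V -> V -> V -> V -> V) : S_space V :=
  linfun (fun X => linfun (fun Y => linfun (fun Z => linfun (f X Y Z)) : 'Hom(V,
    'End(V))) : R_space V).

Lemma mkSE f X Y Z W :
  (forall Y Z W, linear (fun X => f X Y Z W)) ->
  (forall X Z W, linear (fun Y => f X Y Z W)) ->
  (forall X Y W, linear (fun Z => f X Y Z W)) ->
  (forall X Y Z, linear (f X Y Z)) ->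
  mkS f X Y Z W = f X Y Z W.
Proof.
move=> f1 f2 f3 f4.
have e4 x y z w : linfun (f x y z) w = f x y z w by exact: linfunP.
have e3 x y z w : (linfun (fun z => linfun (f x y z)) : 'Hom(V, 'End(V))) z w = f x y z w.
  rewrite linfunP ?e4 // => k z1 z2; apply/lfunP => v.
  by rewrite add_lfunE scale_lfunE !e4 f3.
have e2 x y z w : (linfun (fun y => linfun (fun z => linfun (f x y z)) : 'Hom(V, 'End(V)))
    : R_space V) y z w = f x y z w.
  rewrite linfunP ?e3 // => k y1 y2; apply/lfunP => v; apply/lfunP => u.
  by rewrite !add_lfunE !scale_lfunE !e3 f2.
rewrite /mkS linfunP ?e2 // => k x1 x2; apply/lfunP => v; apply/lfunP => u;
  apply/lfunP => t.
by rewrite !add_lfunE !scale_lfunE !e2 f1.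
Qed.

End Multilinear.

Section Construction.
Variables (R : realType) (n : nat) (V : vectType R) (g : {symmetric V}) (J : 'End(V)).
Local Notation C := (R[i]).
Variables (phi : {linear V -> 'cV[C]_n | real_complex R \; *:%R}) (psi : 'cV[C]_n -> V).
Variable z : 'I_n -> V.
Hypothesis hJ : orthogonal_complex_structure g J.
Hypotheses (phiK : cancel phi psi) (psiK : cancel psi phi).
Hypothesis phiJ : forall v, phi (J v) = 'i%C *: phi v.
Local Notation herm := (herm g J).
Hypothesis zP : forall v b, phi v b 0 = herm v (z b).
Implicit Types (S : S_space V) (A : 'End(V)) (X Y Z W U v : V).
Local Notation "k %:C" := (real_complex R k).
Local Notation gE := (gE hJ).
Local Notation e := (basis_vec psi).
Local Notation clinear := (clinear J).
Local Notation antilinear := (antilinear J).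
Let g_nd := g_nondeg phiK zP.

Lemma clinear_sum (K : finType) (L : K -> V -> C) :
  (forall k, clinear (L k)) -> clinear (fun v => \sum_k L k v).
Proof.
move=> hL; split=> [k x y|x].
  by rewrite mulr_sumr -big_split; apply: eq_bigr => i _; rewrite (hL i).1.
by rewrite mulr_sumr; apply: eq_bigr => i _; rewrite (hL i).2.
Qed.

Lemma antilinear_sum (K : finType) (L : K -> V -> C) :
  (forall k, antilinear (L k)) -> antilinear (fun v => \sum_k L k v).
Proof.
move=> hL; split=> [k x y|x].
  by rewrite mulr_sumr -big_split; apply: eq_bigr => i _; rewrite (hL i).1.
by rewrite mulr_sumr; apply: eq_bigr => i _; rewrite (hL i).2.
Qed.

Lemma herm_injl x y : (forall u, herm x u = herm y u) -> x = y.
Proof. by move=> h; apply: g_nd => u; have := congr1 (@complex.Re R) (h u). Qed.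

Variable T : tensor C n 'I_5.
Hypothesis sT : sym5 T.

Definition FTc X Y W Z a : C := \sum_b \sum_i \sum_j \sum_k
  coef T (idx5 a b i j k) * (phi X i 0 * phi Y j 0 * phi W k 0 * herm (e b) Z).
Definition FT X Y W Z : V := psi (\col_a FTc X Y W Z a).
(* The component antilinear in X and Z; skew-symmetry of S_X(Y,Z) forces
   h(GT(X,Y,W,Z), U) = conj h(FT(X,Z,U,Y), W), see [herm_GT]. *)
Definition GT X Y W Z : V := psi (\col_a conjc (herm (FT X Z (z a) Y) W)).

Lemma phi_FT X Y W Z a : phi (FT X Y W Z) a 0 = FTc X Y W Z a.
Proof. by rewrite psiK mxE. Qed.

Lemma FTc_clin1 a Y W Z : clinear (fun X => FTc X Y W Z a).
Proof.
do 4!(apply: clinear_sum => ?); split=> [k x y|x]; first by rewrite phiP; ring.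
by rewrite phiJ mxE; ring.
Qed.
Lemma FTc_clin2 a X W Z : clinear (fun Y => FTc X Y W Z a).
Proof.
do 4!(apply: clinear_sum => ?); split=> [k x y|x]; first by rewrite phiP; ring.
by rewrite phiJ mxE; ring.
Qed.
Lemma FTc_clin3 a X Y Z : clinear (fun W => FTc X Y W Z a).
Proof.
do 4!(apply: clinear_sum => ?); split=> [k x y|x]; first by rewrite phiP; ring.
by rewrite phiJ mxE; ring.
Qed.
Lemma FTc_anti4 a X Y W : antilinear (fun Z => FTc X Y W Z a).
Proof.
do 4!(apply: antilinear_sum => ?); split=> [k x y|x]; first by rewrite hermPr //; ring.
by rewrite hermJr //; ring.
Qed.

Lemma clinear_V (f : V -> V) : (forall a, clinear (fun v => phi (f v) a 0)) ->
  linear f /\ forall v, f (J v) = J (f v).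
Proof.
move=> h; split=> [k x y|v]; apply: (phi_inj phiK) => a.
  by rewrite (h a).1 phiP.
by rewrite (h a).2 phiJ mxE.
Qed.

Lemma antilinear_V (f : V -> V) : (forall a, antilinear (fun v => phi (f v) a 0)) ->
  linear f /\ forall v, f (J v) = - J (f v).
Proof.
move=> h; split=> [k x y|v]; apply: (phi_inj phiK) => a.
  by rewrite (h a).1 phiP.
by rewrite (h a).2 linearN phiJ !mxE mulNr.
Qed.

Lemma FT1 Y W Z : linear (fun X => FT X Y W Z) /\ forall X, FT (J X) Y W Z = J (FT X Y W
  Z).
Proof.
apply: (@clinear_V (fun X => FT X Y W Z)) => a.
by have [h1 h2] := FTc_clin1 a Y W Z; split=> *; rewrite !phi_FT ?h1 ?h2.
Qed.
Lemma FT2 X W Z : linear (fun Y => FT X Y W Z) /\ forall Y, FT X (J Y) W Z = J (FT X Y W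
  Z).
Proof.
apply: (@clinear_V (fun Y => FT X Y W Z)) => a.
by have [h1 h2] := FTc_clin2 a X W Z; split=> *; rewrite !phi_FT ?h1 ?h2.
Qed.
Lemma FT3 X Y Z : linear (fun W => FT X Y W Z) /\ forall W, FT X Y (J W) Z = J (FT X Y W
  Z).
Proof.
apply: (@clinear_V (fun W => FT X Y W Z)) => a.
by have [h1 h2] := FTc_clin3 a X Y Z; split=> *; rewrite !phi_FT ?h1 ?h2.
Qed.
Lemma FT4 X Y W : linear (FT X Y W) /\ forall Z, FT X Y W (J Z) = - J (FT X Y W Z).
Proof.
apply: antilinear_V => a.
by have [h1 h2] := FTc_anti4 a X Y W; split=> *; rewrite !phi_FT ?h1 ?h2.
Qed.

Lemma FTC12 X Y W Z : FT X Y W Z = FT Y X W Z.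
Proof.
apply: (phi_inj phiK) => a; rewrite !phi_FT; apply: eq_bigr => b _.
rewrite exchange_big; apply: eq_bigr => i _; apply: eq_bigr => j _; apply: eq_bigr => k _.
by have [_ s _] := sT; rewrite s; ring.
Qed.

Lemma FTC23 X Y W Z : FT X Y W Z = FT X W Y Z.
Proof.
apply: (phi_inj phiK) => a; rewrite !phi_FT; apply: eq_bigr => b _.
apply: eq_bigr => i _; rewrite exchange_big; apply: eq_bigr => j _; apply: eq_bigr => k _.
by have [_ _ s] := sT; rewrite s; ring.
Qed.

Lemma herm_FTC X Y W Z U : herm (FT X Y W Z) U = herm (FT X Y W U) Z.
Proof.
rewrite (antilinearE hJ phiK psiK phiJ zP U (herm_antilinear hJ _)).
rewrite (antilinearE hJ phiK psiK phiJ zP Z (herm_antilinear hJ _)).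
under eq_bigr => a _ do rewrite -zP phi_FT mulr_sumr.
under [RHS]eq_bigr => a _ do rewrite -zP phi_FT mulr_sumr.
rewrite exchange_big; apply: eq_bigr => a _; apply: eq_bigr => b _.
rewrite !mulr_sumr; apply: eq_bigr => i _; rewrite !mulr_sumr; apply: eq_bigr => j _.
rewrite !mulr_sumr; apply: eq_bigr => k _.
by have [s _ _] := sT; rewrite s; ring.
Qed.

Lemma herm_GT X Y W Z U : herm (GT X Y W Z) U = conjc (herm (FT X Z U Y) W).
Proof.
have aL : antilinear (fun U => conjc (herm (FT X Z U Y) W)).
  split=> [k x y|x].
    have [h _] := FT3 X Z Y; rewrite h hermP // rmorphD rmorphM; congr (_ * _ + _).
    by apply: complexP; rewrite /= ?oppr0.
  have [_ h] := FT3 X Z Y; rewrite h hermJ // rmorphM; congr (_ * _).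
  by apply: complexP; rewrite /= ?oppr0.
rewrite (antilinearE hJ phiK psiK phiJ zP U (herm_antilinear hJ _)).
rewrite (antilinearE hJ phiK psiK phiJ zP U aL).
by apply: eq_bigr => a _; rewrite -zP /GT psiK mxE.
Qed.

Lemma hermN x y : herm (- x) y = - herm x y.
Proof. by apply: complexP; rewrite /herm !gE. Qed.
Lemma hermD x y v : herm (x + y) v = herm x v + herm y v.
Proof. by apply: complexP; rewrite /herm !gE. Qed.

Lemma hermZ k x v : herm (k *: x) v = k%:C * herm x v.
Proof. by apply: complexP; rewrite /herm !gE /=; ring. Qed.
Definition hE := (hermN, hermD, hermZ).

Lemma conjcD (x y : C) : conjc (x + y) = conjc x + conjc y. Proof. exact: rmorphD. Qed.
Lemma conjcM (x y : C) : conjc (x * y) = conjc x * conjc y. Proof. exact: rmorphM. Qed.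
Lemma conjcN (x : C) : conjc (- x) = - conjc x. Proof. exact: rmorphN. Qed.
Lemma conjcR k : conjc (k%:C) = k%:C. Proof. by apply: complexP; rewrite /= ?oppr0. Qed.
Lemma conjci : conjc 'i%C = - 'i%C :> C. Proof. by apply: complexP;
  rewrite /= ?oppr0. Qed.
Definition cE := (conjcD, conjcM, conjcN, conjcR, conjci, conjcK).

Lemma GT1 Y W Z : linear (fun X => GT X Y W Z) /\ forall X, GT (J X) Y W Z = - J (GT X Y
  W Z).
Proof.
split=> [k x y|x]; apply: herm_injl => u; rewrite !(hE, herm_GT, hermJ hJ).
  by rewrite (FT1 _ _ _).1 !(hE, cE).
by rewrite (FT1 _ _ _).2 (hermJ hJ) !cE mulNr.
Qed.
Lemma GT2 X W Z : linear (fun Y => GT X Y W Z) /\ forall Y, GT X (J Y) W Z = J (GT X Y W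
  Z).
Proof.
split=> [k x y|x]; apply: herm_injl => u; rewrite !(hE, herm_GT, hermJ hJ).
  by rewrite (FT4 _ _ _).1 !(hE, cE).
by rewrite (FT4 _ _ _).2 !(hE, hermJ hJ) !cE; ring.
Qed.
Lemma GT3 X Y Z : linear (fun W => GT X Y W Z) /\ forall W, GT X Y (J W) Z = J (GT X Y W
  Z).
Proof.
split=> [k x y|x]; apply: herm_injl => u; rewrite !(hE, herm_GT, hermJ hJ).
  by rewrite (hermPr hJ) !(hE, cE).
by rewrite (hermJr hJ) !(hE, cE); ring.
Qed.
Lemma GT4 X Y W : linear (GT X Y W) /\ forall Z, GT X Y W (J Z) = - J (GT X Y W Z).
Proof.
split=> [k x y|x]; apply: herm_injl => u; rewrite !(hE, herm_GT, hermJ hJ).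
  by rewrite (FT2 _ _ _).1 !(hE, cE).
by rewrite (FT2 _ _ _).2 !(hE, hermJ hJ) !cE; ring.
Qed.

Lemma GTC14 X Y W Z : GT X Y W Z = GT Z Y W X.
Proof. by apply: herm_injl => U; rewrite !herm_GT FTC12. Qed.
Lemma GTC23 X Y W Z : GT X Y W Z = GT X W Y Z.
Proof. by apply: herm_injl => U; rewrite !herm_GT herm_FTC. Qed.

(** [FT] and [GT] together form the part linear in Y and antilinear in Z; alternation in Y and Z
    supplies the rest. *)
Definition ST X Y Z W : V := FT X Y W Z + GT X Y W Z - FT X Z W Y - GT X Z W Y.
Definition Phi : S_space V := mkS ST.

Lemma linear_comb4 (f1 f2 f3 f4 : V -> V) : linear f1 -> linear f2 -> linear f3 -> linear
  f4 ->
  linear (fun v => f1 v + f2 v - f3 v - f4 v).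
Proof.
move=> l1 l2 l3 l4 k x y; apply: g_nd => u.
rewrite l1 l2 l3 l4 !(lfE, gE); ring.
Qed.

Lemma PhiE X Y Z W : Phi X Y Z W = ST X Y Z W.
Proof.
rewrite /Phi mkSE // => *.
- exact: (linear_comb4 (FT1 _ _ _).1 (GT1 _ _ _).1 (FT1 _ _ _).1 (GT1 _ _ _).1).
- exact: (linear_comb4 (FT2 _ _ _).1 (GT2 _ _ _).1 (FT4 _ _ _).1 (GT4 _ _ _).1).
- exact: (linear_comb4 (FT4 _ _ _).1 (GT4 _ _ _).1 (FT2 _ _ _).1 (GT2 _ _ _).1).
- exact: (linear_comb4 (FT3 _ _ _).1 (GT3 _ _ _).1 (FT3 _ _ _).1 (GT3 _ _ _).1).
Qed.

(** First Bianchi follows from the symmetry of [FT] and [GT] in Y and W, second Bianchi from that of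
    [FT] in X, Y and of [GT] in X, Z. Skewness is the relation defining [GT]. *)
Lemma Phi_nabla : nabla_curvature_space (u_algebra g J) Phi.
Proof.
split=> [X|X Y Z].
  split=> [Y|Y Z|Y Z W].
  - apply/lfunP => W; rewrite PhiE zero_lfunE /ST; apply: g_nd => U; rewrite !gE; ring.
  - split=> [W U|].
      have h : herm (Phi X Y Z W) U + conjc (herm (Phi X Y Z U) W) = 0.
        by rewrite !PhiE /ST !(hE, herm_GT, cE); ring.
      have := congr1 (@complex.Re R) h; rewrite /herm /= => {}h.
      by rewrite [g W _]gC.
    apply/lfunP => W; rewrite !comp_lfunE !PhiE /ST !(FT3 _ _ _).2 !(GT3 _ _ _).2.
    by rewrite !lfE.
  - rewrite !PhiE /ST (GTC23 X W Z) (GTC23 X Y W) (GTC23 X Z Y) (FTC23 X W Z) (FTC23 X Y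
    W) (FTC23 X Z Y).
    apply: g_nd => U; rewrite !gE; ring.
apply/lfunP => W; rewrite !add_lfunE zero_lfunE !PhiE /ST.
rewrite (GTC14 Z X) (GTC14 Z Y) (GTC14 Y Z) (GTC14 Y X) (FTC12 Z X) (FTC12 Z Y) (FTC12 Y
  X).
apply: g_nd => U; rewrite !gE; ring.
Qed.

Lemma Psi_Phi : Psi J phi psi z Phi = T.
Proof.
apply: tensor5P => a b i j k; rewrite coef_mk5.
(* [holo] is the projection onto one type, and only the first term of [ST] has that type. *)
have -> : holo J Phi (e i) (e j) (e k) (z b) = FT (e i) (e j) (e k) (z b).
  rewrite /holo !PhiE /ST; apply: g_nd => U.
  rewrite !((FT1 _ _ _).2, (FT2 _ _ _).2, (FT3 _ _ _).2, (FT4 _ _ _).2).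
  rewrite !((GT1 _ _ _).2, (GT2 _ _ _).2, (GT3 _ _ _).2, (GT4 _ _ _).2).
  rewrite !(lfE, gE); lra.
rewrite phi_FT /FTc.
rewrite (bigD1 b) //= (bigD1 i) //= (bigD1 j) //= (bigD1 k) //= !(phi_e psiK) -zP !(phi_e
  psiK) !eqxx.
rewrite !mulr1 !big1 ?addr0 // => [b' /negbTE kk|i' /negbTE kk|j' /negbTE kk|k' /negbTE
  kk].
- by do 3!(rewrite big1 // => ? _); rewrite -zP (phi_e psiK) eq_sym kk !mulr0.
- by rewrite big1 // => *; rewrite big1 // => *; rewrite !(phi_e psiK) kk !mul0r mulr0.
- by rewrite big1 // => *; rewrite !(phi_e psiK) kk mulr0 !mul0r mulr0.
- by rewrite !(phi_e psiK) kk mulr0 mul0r mulr0.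
Qed.

End Construction.

(** * Irreducible modules and highest weights *)

Section Riesz.
Variables (R : realType) (V : vectType R) (g : {symmetric V}).

Lemma signature_riesz r s (L : V -> R) : signature g r s ->
  (forall k x y, L (k *: x + y) = k * L x + L y) -> exists z, forall v, g v z = L v.
Proof.
case=> b [bV gb] LP.
pose Lf := linfun (L : V -> R^o).
have LE v : Lf v = L v by apply: linfunP => k x y; exact: LP.
pose sg (i : 'I_(r + s)) : R := if (i < r)%N then 1 else -1.
exists (\sum_i (sg i * L b`_i) *: b`_i) => v.
have g_suml (f : 'I_(r + s) -> V) u : g (\sum_i f i) u = \sum_i g (f i) u.
  by apply: (big_morph (g^~ u)) => [x y|]; [exact: gD | exact: g0].
have -> : v = \sum_i coord b i v *: b`_i by exact: (coord_basis bV (memvf v)).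
rewrite -LE g_suml [RHS]linear_sum; apply: eq_bigr => i _.
rewrite [RHS]linearZ /= LE gZ gC g_suml (bigD1 i) //= big1 => [|j /negbTE ji].
  by rewrite gZ gb eqxx /= /sg addr0; case: ifP => _; congr (_ * _); ring.
by rewrite gZ gb ji mulr0.
Qed.
End Riesz.

Section ComplexModule.
Variables (R : realType) (n : nat) (I : finType) (up : pred I).
Local Notation C := (R[i]).
Hypothesis n2 : (2 <= n)%N.
Variables (W : {vspace tensor C n I}).
Hypothesis WP : forall T, T \in W <-> traceless up T.
Variable theta : {linear 'M[C]_n -> 'M[C]_n}.
Hypothesis thetaM : forall A B, theta (A *m B - B *m A) = theta A *m theta B - theta B *m
  theta A.
Hypothesis theta_surj : forall B, exists A, theta A = B.

Definition first_index : 'I_n := Ordinal (ltnW n2).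
Lemma last_index_subproof : (n.-1 < n)%N. Proof. by case: n n2. Qed.
Definition last_index : 'I_n := Ordinal last_index_subproof.
Local Notation i0 := first_index.
Local Notation i1 := last_index.
Lemma first_neq_last : i0 != i1. Proof. by rewrite -val_eqE /=; case: n n2 => [|[]]. Qed.

Lemma traceless_simple (U : tensor C n I -> Prop) :
  submodule up U -> (forall x, U x -> traceless up x) ->
  (exists2 x, U x & x != 0) -> forall x, traceless up x -> U x.
Proof.
move=> sU UW U0; apply: (traceless_irreducible (i0 := i0) (i1 := i1)) => //.
- exact: first_neq_last.
- exact: traceless_submodule.
Qed.

Lemma exists_traceless : exists2 T : tensor C n I, traceless up T & T != 0.
Proof.
exists (pure up (delta_mx i0 0) (delta_mx 0 i1)).
  by apply: traceless_pure; rewrite mul_delta_mx_0 // eq_sym first_neq_last.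
apply: pure_neq0; apply/eqP => /matrixP.
  by move/(_ i0 0); rewrite !mxE !eqxx => /eqP; rewrite oner_eq0.
by move/(_ 0 i1); rewrite !mxE !eqxx => /eqP; rewrite oner_eq0.
Qed.

(** A surjective [theta] leaves the set of operators, hence the submodules, unchanged. It will be
    the identity or [dual_twist]. *)
Lemma rep_irreducible : gl_irreducible (rep up W \o theta).
Proof.
split=> [A B|].
  by rewrite /= thetaM rep_comm.
have tact_closed (U : {vspace subvs_of W}) :
    (forall a, range (rep up W \o theta) a -> (a @: U <= U)%VS) ->
    forall B x, x \in U -> rep up W B x \in U.
  move=> hU B x xU; have [A <-] := theta_surj B.
  by apply/(subvP (hU _ _))/memv_img => //; exists A.
split.
- have [T hT T0] := exists_traceless; apply: contraNneq T0 => f0.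
  have : vsproj W T \in (fullv : {vspace subvs_of W}) by exact: memvf.
  rewrite f0 memv0 => /eqP/(congr1 vsval); rewrite vsprojK ?linear0 => [->//|].
  exact/WP.
- by move=> a _; exact: subvf.
move=> U _ hU; have [->|U0] := eqVneq U 0%VS; [by left | right].
apply/vspaceP => x; rewrite memvf.
pose P (T : tensor C n I) := exists2 y, y \in U & vsval y = T.
suff [y yU yx] : P (vsval x) by rewrite -(val_inj yx).
apply: traceless_simple.
- split=> [|k _ _ [x1 x1U <-] [x2 x2U <-]|B _ [y yU <-]].
  + by exists 0; rewrite ?mem0v ?linear0.
  + by exists (k *: x1 + x2); rewrite ?memvD ?memvZ ?linearP.
  + by exists (rep up W B y); [exact: tact_closed | rewrite vsval_rep].
- by move=> _ [y _ <-]; apply/WP/subvsP.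
- exists (vsval (vpick U)); first by exists (vpick U) => //; exact: memv_pick.
  by apply: contraNneq U0 => h; rewrite -vpick0; apply/eqP/val_inj.
- exact/WP/subvsP.
Qed.

Lemma rep_scalar c : theta c%:M = c%:M -> 
  rep up W (theta c%:M) = ((\sum_s eps C up s) * c) *: \1%VF.
Proof.
move=> ->; apply/lfunP => x; apply: val_inj => /=.
by rewrite vsval_rep // tact_scalar scale_lfunE id_lfunE linearZ.
Qed.

End ComplexModule.

(** * Highest weights of the two complex modules *)

Section HighestWeights.
Variables (R : realType) (n : nat).
Local Notation C := (R[i]).
Hypothesis n2 : (2 <= n)%N.
Local Notation i0 := (first_index n2).
Local Notation i1 := (last_index n2).

Lemma sum_up3 (x y : C) : \sum_s (if up3 s then x else y) = x + 2 * y.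
Proof. by rewrite !big_ord_recl big_ord0 /=; ring. Qed.
Lemma sum_up5 (x y : C) : \sum_s (if up5 s then x else y) = 2 * x + 3 * y.
Proof. by rewrite !big_ord_recl big_ord0 /=; ring. Qed.

Lemma fund_weight1 (H : 'M[C]_n) : fund_weight 1 H = H i0 i0.
Proof.
rewrite /fund_weight (bigD1 i0) //= big1 ?addr0 // => j /andP[j0].
by rewrite -val_eqE /=; case: (val j) j0.
Qed.

Lemma fund_weightn (H : 'M[C]_n) : \tr H = 0 -> fund_weight n.-1 H = - H i1 i1.
Proof.
rewrite /mxtrace (bigD1 i1) //= addrC => /eqP; rewrite addr_eq0 => /eqP <-.
apply: eq_bigl => j; rewrite -val_eqE /=; have := ltn_ord j; lia.
Qed.

Lemma raise_first (E : 'M[C]_n) :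
  (forall i j : 'I_n, (j <= i)%N -> E i j = 0) -> E *m delta_mx i0 (0 : 'I_1) = 0.
Proof.
move=> hE; apply/matrixP => i j; rewrite mxE mxE (bigD1 i0) //= hE // mul0r add0r.
by rewrite big1 // => k /negbTE k0; rewrite !mxE k0 mulr0.
Qed.

Lemma raise_last (E : 'M[C]_n) :
  (forall i j : 'I_n, (j <= i)%N -> E i j = 0) -> delta_mx (0 : 'I_1) i1 *m E = 0.
Proof.
move=> hE; apply/matrixP => i j; rewrite mxE mxE (bigD1 i1) //= hE ?mulr0 ?add0r.
  by rewrite big1 // => k /negbTE k0; rewrite !mxE k0 andbF mul0r.
by have := ltn_ord j; rewrite /=; lia.
Qed.

Lemma diag_delta (H : 'M[C]_n) i : is_diag_mx H ->
  H *m delta_mx i (0 : 'I_1) = H i i *: delta_mx i 0.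
Proof.
move/is_diag_mxP => hH; apply/matrixP => k j; rewrite !mxE (bigD1 i) //= !mxE eqxx.
rewrite big1 => [|l /negbTE li]; last by rewrite !mxE li mulr0.
rewrite addr0 ord1 eqxx !andbT; case: eqVneq => [->|ki]; first by rewrite mulr1.
by rewrite hH ?mul0r ?mulr0 // neq_ltn.
Qed.

Lemma diag_deltal (H : 'M[C]_n) i : is_diag_mx H ->
  delta_mx (0 : 'I_1) i *m H = H i i *: delta_mx 0 i.
Proof.
move/is_diag_mxP => hH; apply/matrixP => j k; rewrite !mxE (bigD1 i) //= !mxE eqxx.
rewrite big1 => [|l /negbTE li]; last by rewrite !mxE li andbF mul0r.
rewrite addr0 ord1 eqxx mul1r /=; case: eqVneq => [->|ki]; first by rewrite mulr1.
by rewrite hH ?mulr0 // eq_sym.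
Qed.

Lemma rep_highest_weight (I : finType) (up : pred I) (W : {vspace tensor C n I})
    (theta : {linear 'M[C]_n -> 'M[C]_n}) (u : 'cV[C]_n) (l : 'rV[C]_n) (L : 'M[C]_n ->
      C) :
  (forall T, T \in W <-> traceless up T) -> u != 0 -> l != 0 -> l *m u = 0 ->
  (forall E : 'M[C]_n, (forall i j : 'I_n, (j <= i)%N -> E i j = 0) ->
    theta E *m u = 0 /\ l *m theta E = 0) ->
  (forall H : 'M[C]_n, is_diag_mx H -> \tr H = 0 -> exists x y,
    [/\ theta H *m u = x *: u, l *m theta H = y *: l
      & L H = \sum_s if up s then x else - y]) ->
  has_highest_weight (rep up W \o theta) L.
Proof.
move=> WP u0 l0 lu hE hH; have tv : pure up u l \in W by apply/WP/traceless_pure.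
have v0 : vsproj W (pure up u l) != 0.
  apply/eqP => /(congr1 vsval); rewrite vsprojK // linear0.
  exact/eqP/pure_neq0.
exists (vsproj W (pure up u l)) => //; split=> [E /hE[Eu lE]|H dH tH]; apply: val_inj;
    rewrite /= vsval_rep // vsprojK //.
  rewrite -(scale0r u) in Eu; rewrite -(scale0r l) in lE.
  rewrite (tact_pure up Eu lE) big1 => [|s _]; last by rewrite oppr0 if_same.
  by rewrite scale0r.
have [x [y [Hu lH ->]]] := hH H dH tH.
by rewrite (tact_pure up Hu lH).
Qed.

Lemma delta_col0 i : delta_mx i 0 != 0 :> 'cV[C]_n.
Proof. by apply/eqP => /matrixP/(_ i 0); rewrite !mxE !eqxx => /eqP;
  rewrite oner_eq0. Qed.
Lemma delta_row0 i : delta_mx 0 i != 0 :> 'rV[C]_n.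
Proof. by apply/eqP => /matrixP/(_ 0 i); rewrite !mxE !eqxx => /eqP;
  rewrite oner_eq0. Qed.

Lemma is_V12 (W : {vspace tensor C n 'I_3}) :
  (forall T, T \in W <-> traceless up3 T) -> is_V (rep up3 W \o idfun) 1 2.
Proof.
move=> WP; split; first by apply: rep_irreducible => //= B; exists B.
- apply: (rep_highest_weight (u := delta_mx i0 0) (l := delta_mx 0 i1)) => //.
  + exact: delta_col0.
  + exact: delta_row0.
  + by rewrite mul_delta_mx_0 // eq_sym first_neq_last.
  + by move=> E hE; rewrite raise_first ?raise_last.
  move=> H dH tH; exists (H i0 i0), (H i1 i1); rewrite diag_delta // diag_deltal //.
  by split=> //; rewrite sum_up3 fund_weight1 fund_weightn // mul1r.
move=> c; have := @rep_scalar R n _ up3 W WP idfun c erefl.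
by rewrite /= => ->; rewrite /eps sum_up3; congr (_ *: _); ring.
Qed.

Variable K : 'M[C]_n.
Hypothesis uK : K \in unitmx.
(* With K the conjugate Gram matrix of h on the dual basis, this is entrywise
   conjugation on u(p,q), see [conj_gl]. *)
Definition dual_twist (B : 'M[C]_n) : 'M[C]_n := - (K *m B^T *m invmx K).

Lemma dual_twist_is_linear : linear dual_twist.
Proof.
by move=> k A B; rewrite /dual_twist linearP /= mulmxDr mulmxDl -scalemxAr -scalemxAl
  opprD scalerN.
Qed.
HB.instance Definition _ :=
  GRing.isLinear.Build C 'M[C]_n 'M[C]_n *:%R dual_twist dual_twist_is_linear.

Lemma dual_twistM A B : dual_twist (A *m B - B *m A) =
  dual_twist A *m dual_twist B - dual_twist B *m dual_twist A.
Proof.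
have h X Y : dual_twist X *m dual_twist Y = K *m (Y *m X)^T *m invmx K.
  by rewrite /dual_twist mulNmx mulmxN opprK trmx_mul !mulmxA mulmxKV.
by rewrite linearB !h /= /dual_twist opprK addrC.
Qed.

Lemma dual_twist_surj B : exists A, dual_twist A = B.
Proof.
exists (- (invmx K *m B *m K)^T).
by rewrite /dual_twist linearN /= trmxK mulmxN mulNmx opprK !mulmxA mulmxV // mul1mx
  mulmxK.
Qed.

Lemma is_V32 (W : {vspace tensor C n 'I_5}) :
  (forall T, T \in W <-> traceless up5 T) -> is_V (rep up5 W \o dual_twist) 3 2.
Proof.
move=> WP.
have tu x B : B^T *m x = 0 -> dual_twist B *m (K *m x) = 0 :> 'cV[C]_n.
  by move=> h; rewrite /dual_twist mulNmx mulmxA mulmxKV // -mulmxA h mulmx0 oppr0.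
have tu2 x B k : B^T *m x = k *: x -> dual_twist B *m (K *m x) = (- k) *: (K *m x) :>
  'cV[C]_n.
  by move=> h; rewrite /dual_twist mulNmx mulmxA mulmxKV // -mulmxA h -scalemxAr scaleNr.
have tl2 x B k : x *m B^T = k *: x ->
    (x *m invmx K) *m dual_twist B = (- k) *: (x *m invmx K) :> 'rV[C]_n.
  by move=> h; rewrite /dual_twist mulmxN !mulmxA mulmxKV // h -scalemxAl scaleNr.
split.
- by apply: rep_irreducible => //; [exact: dual_twistM | exact: dual_twist_surj].
(* The twist transposes and negates, so first and last index change roles: H acts on [u] by -H_last
   and on [l] by -H_first, which gives the weight 3 H_first - 2 H_last. *)
- apply: (rep_highest_weight (u := K *m delta_mx i1 0) (l := delta_mx 0 i0 *m invmx K))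
  => //.
  + apply/eqP => /(congr1 (mulmx (invmx K))); rewrite mulKmx // mulmx0.
    exact/eqP/delta_col0.
  + apply/eqP => /(congr1 (mulmx^~ K)); rewrite mulmxKV // mul0mx.
    exact/eqP/delta_row0.
  + by rewrite mulmxA mulmxKV // mul_delta_mx_0 // first_neq_last.
  + move=> E hE; rewrite (tu2 _ _ 0) ?(tl2 _ _ 0) ?oppr0 ?scale0r //.
      by apply: trmx_inj; rewrite trmx_mul trmxK trmx_delta raise_first // trmx0.
    by apply: trmx_inj; rewrite trmx_mul trmxK trmx_delta raise_last // trmx0.
  move=> H dH tH; exists (- H i1 i1), (- H i0 i0).
  rewrite (tu2 _ _ (H i1 i1)) ?(tl2 _ _ (H i0 i0)).
  + by split=> //; rewrite sum_up5 fund_weight1 fund_weightn //; ring.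
  + by apply: trmx_inj; rewrite trmx_mul trmxK linearZ /= !trmx_delta diag_delta.
  + by apply: trmx_inj; rewrite trmx_mul trmxK linearZ /= !trmx_delta diag_deltal.
have tc c : dual_twist c%:M = (- c)%:M.
  by rewrite /dual_twist tr_scalar_mx mul_mx_scalar -scalemxAl mulmxV // scalemx1 raddfN.
move=> c; rewrite [X in X = _]/= tc.
have := @rep_scalar R n _ up5 W WP idfun (- c) erefl.
by rewrite /= => ->; rewrite /eps sum_up5; congr (_ *: _); ring.
Qed.

End HighestWeights.

(** * Real submodules and the decomposition *)

Section RealModules.
Variables (R : realType) (n : nat) (V : vectType R) (g : {symmetric V}) (J : 'End(V)).
Local Notation C := (R[i]).
Variables (phi : {linear V -> 'cV[C]_n | real_complex R \; *:%R}) (psi : 'cV[C]_n -> V).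
Variable z : 'I_n -> V.
Hypothesis n2 : (2 <= n)%N.
Hypothesis hJ : orthogonal_complex_structure g J.
Hypotheses (phiK : cancel phi psi) (psiK : cancel psi phi).
Hypothesis phiJ : forall v, phi (J v) = 'i%C *: phi v.
Local Notation herm := (herm g J).
Hypothesis zP : forall v b, phi v b 0 = herm v (z b).
Implicit Types (S : S_space V) (A : 'End(V)) (X Y Z W U v : V) (Q : {vspace S_space V}).
Local Notation "k %:C" := (real_complex R k).
Local Notation gE := (gE hJ).
Local Notation e := (basis_vec psi).
Local Notation clinear := (clinear J).
Local Notation antilinear := (antilinear J).
Local Notation gl := (gl_mx phi psi).
Local Notation u := (u_algebra g J).
Let g_nd := g_nondeg phiK zP.

Definition mkA (B : 'M[C]_n) : 'End(V) := linfun (fun v => psi (B *m phi v)).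

Lemma phi_mkA B v : phi (mkA B v) = B *m phi v.
Proof.
rewrite linfunP ?psiK // => k x y; apply: (can_inj phiK).
by rewrite !psiK !linearP /= !psiK.
Qed.

Lemma mkA_J B v : mkA B (J v) = J (mkA B v).
Proof. by apply: (can_inj phiK); rewrite phiJ !phi_mkA phiJ -scalemxAr. Qed.

Lemma gl_J : gl J = ('i%C)%:M.
Proof. by apply/matrixP => i j; rewrite mxE phiJ psiK !mxE eqxx andbT mulr_natr. Qed.

(** The h-adjoint of a J-linear map: coordinate i of the image of [e j] has to be its product with
    [z i], that is [herm (e j) (A (z i))]. *)
Definition adj (A : 'End(V)) : 'End(V) :=
  mkA (\matrix_(i, j) herm (e j) (A (z i))).

Lemma herm_adj A x y : (forall v, A (J v) = J (A v)) -> herm (adj A y) x = herm y (A x).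
Proof.
move=> AJ.
have a1 : antilinear (fun x => herm y (A x)).
  split=> [k v w|v]; first by rewrite linearP hermPr.
  by rewrite AJ hermJr.
rewrite (antilinearE hJ phiK psiK phiJ zP x (herm_antilinear hJ _)).
rewrite (antilinearE hJ phiK psiK phiJ zP x a1); apply: eq_bigr => i _; congr (_ * _).
have c1 : clinear (fun y => herm (adj A y) (z i)).
  split=> [k v w|v]; first by rewrite linearP hermP.
  by rewrite mkA_J hermJ.
rewrite (clinearE phiK psiK phiJ y c1).
rewrite (clinearE phiK psiK phiJ y (herm_clinear hJ _)); apply: eq_bigr => j _.
congr (_ * _); rewrite -zP phi_mkA psiK mxE (bigD1 j) //= big1 ?addr0.
  by rewrite !mxE !eqxx mulr1.
by move=> k /negbTE kj; rewrite !mxE kj mulr0.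
Qed.

Lemma u_of_herm A : (forall v, A (J v) = J (A v)) ->
  (forall x y, herm (A x) y + herm x (A y) = 0) -> u A.
Proof.
move=> AJ h; split=> [x y|]; first by have := congr1 (@complex.Re R) (h x y).
by apply/lfunP => x; rewrite !comp_lfunE AJ.
Qed.

Lemma u_Jmem : u J.
Proof.
apply: u_of_herm => // x y.
by rewrite hermJ // hermJr //; ring.
Qed.

(** The decomposition into skew and self-adjoint parts for h; -J times a self-adjoint map is skew,
    which gives the second element of u(p,q). *)
Lemma gl_split A : (forall v, A (J v) = J (A v)) ->
  exists A1 A2, [/\ u A1, u A2 & gl A = gl A1 + 'i%C *: gl A2].
Proof.
move=> AJ; have adjJ v : adj A (J v) = J (adj A v) by exact: mkA_J.
have h1 x y := @herm_adj A x y AJ.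
have h2 x y : herm (A x) y = herm x (adj A y).
  by rewrite [LHS](hermC hJ) -h1 [RHS](hermC hJ).
pose A1 : 'End(V) := (2^-1) *: (A - adj A).
pose A2 : 'End(V) := (- 2^-1) *: (J \o (A + adj A))%VF.
have hE' := hE.
have hr x y v : herm x (y + v) = herm x y + herm x v.
  by rewrite -[in LHS](scale1r y) hermPr // rmorph1 mul1r.
have hz k x y : herm x (k *: y) = k%:C * herm x y.
  by rewrite -[_ *: _]addr0 hermPr // (rlinear0 (herm_antilinear hJ x).1) addr0.
have hn x y : herm x (- y) = - herm x y by rewrite -scaleN1r hz rmorphN rmorph1 mulN1r.
exists A1, A2; split.
- apply: u_of_herm => [v|x y]; first by rewrite /A1 !lfE AJ adjJ.
  by rewrite /A1 !lfE !(hE', hr, hz, hn) h1 h2; ring.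
- apply: u_of_herm => [v|x y]; first by rewrite /A2 !(lfE, comp_lfunE) AJ adjJ.
  by rewrite /A2 !(lfE, comp_lfunE) !(hE', hr, hz, hn, hermJ hJ, hermJr hJ) h1 h2; ring.
apply/matrixP => i j; rewrite !mxE; set x := psi _.
have -> : A x = A1 x + J (A2 x).
  apply: herm_injl phiK zP _ _ _ => v;
    rewrite /A1 /A2 !(lfE, comp_lfunE) !(JJ hJ) !hE' !rmorphN !fmorphV !rmorph_nat;
    by field.
by rewrite linearD phiJ !mxE.
Qed.

Definition rlinear_tensor (I : finType) (f : S_space V -> tensor C n I) : Prop :=
  forall k S1 S2, f (k *: S1 + S2) = k%:C *: f S1 + f S2.

Section Transfer.
Variables (I : finType) (up : pred I) (Q : {vspace S_space V}).
Variable f : S_space V -> tensor C n I.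
Hypothesis fP : rlinear_tensor f.
Hypothesis fQ : forall S, S \in Q -> traceless up (f S).
Hypothesis f_inj : forall S, S \in Q -> f S = 0 -> S = 0.
Hypothesis f_surj : forall T, traceless up T -> exists2 S, S \in Q & f S = T.

Lemma rlinear_tensor0 : f 0 = 0.
Proof. by have := fP 1 0 0; rewrite scaler0 addr0 rmorph1 scale1r => /eqP;
  rewrite -subr_eq subrr eq_sym => /eqP. Qed.
Lemma rlinear_tensorD S1 S2 : f (S1 + S2) = f S1 + f S2.
Proof. by rewrite -[S1]scale1r fP rmorph1 !scale1r. Qed.
Lemma rlinear_tensorB S1 S2 : f (S1 - S2) = f S1 - f S2.
Proof. by rewrite -scaleN1r addrC fP rmorphN rmorph1 scaleN1r addrC. Qed.
Lemma transfer_inj S1 S2 : S1 \in Q -> S2 \in Q -> f S1 = f S2 -> S1 = S2.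
Proof. by move=> h1 h2 h; apply/subr0_eq/f_inj;
  [exact: rpredB | rewrite rlinear_tensorB h subrr]. Qed.

Lemma transfer_irreducible :
  (forall A S, u A -> S \in Q -> S_act A S \in Q) ->
  (forall A S, u A -> S \in Q -> f (S_act A S) = tact up (gl A) (f S)) ->
  \sum_s eps C up s = -1 ->
  irreducible [set S_act A | A in u]%classic Q.
Proof.
move=> Qact fact eps1; split.
- have [T hT T0] := exists_traceless R up n2; have [S SQ fS] := f_surj hT.
  apply: contraNneq T0 => Q0; move: SQ; rewrite Q0 memv0 => /eqP S0.
  by rewrite -fS S0 rlinear_tensor0.
- by move=> _ [A uA <-]; apply/subvP => _ /memv_imgP[S SQ ->]; exact: Qact.
move=> W WQ hW; have [->|W0] := eqVneq W 0%VS; [by left | right].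
have Wact A S : u A -> S \in W -> S_act A S \in W.
  by move=> uA SW; apply/(subvP (hW (S_act A) _))/memv_img => //; exists A.
have WQ' S : S \in W -> S \in Q by exact: subvP.
pose P T := exists2 S, S \in W & f S = T.
have Pr k T1 T2 : P T1 -> P T2 -> P (k%:C *: T1 + T2).
  by move=> [S1 h1 <-] [S2 h2 <-]; exists (k *: S1 + S2); rewrite ?fP ?rpredD ?rpredZ.
have P0 : P 0 by exists 0; rewrite ?mem0v ?rlinear_tensor0.
have Pu A T : u A -> P T -> P (tact up (gl A) T).
  by move=> uA [S SW <-]; exists (S_act A S); rewrite ?fact ?Wact ?WQ'.
(* [J] acts on the tensors by -i, because the signs of the slots add up to -1; negating gives
   multiplication by i. *)
have Pi T : P T -> P ('i%C *: T).
  move=> PT; have := Pr (-1) _ _ (Pu _ _ (u_Jmem) PT) P0.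
  by rewrite gl_J tact_scalar eps1 addr0 rmorphN rmorph1 mulN1r scaleN1r scaleNr opprK.
have PD T1 T2 : P T1 -> P T2 -> P (T1 + T2).
  by move=> h1 h2; have := Pr 1 _ _ h1 h2; rewrite rmorph1 scale1r.
have PZ k T : P T -> P (k *: T).
  move=> PT; rewrite [k]complexE scalerDl -scalerA.
  have PR r T' : P T' -> P (r%:C *: T') by move=> PT'; rewrite -[_ *: _]addr0; exact: Pr.
  by apply: PD; [exact: PR | apply/Pi/PR].
have sP : submodule up P.
  split=> // [k x y Px Py|B x Px]; first by apply: PD => //; exact: PZ.
  have [A1 [A2 [u1 u2 BE]]] := gl_split (mkA_J B).
  have -> : B = 'i%C *: gl A2 + gl A1.
    rewrite addrC -BE; apply/matrixP => i j; rewrite mxE phi_mkA psiK mxE (bigD1 j) //=.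
    rewrite big1 => [|k /negbTE kj]; first by rewrite mxE !eqxx mulr1 addr0.
    by rewrite !mxE kj mulr0.
  by rewrite tactPl; apply: PD; [apply/PZ/Pu | exact: Pu].
apply/vspaceP => S; apply/idP/idP => [/WQ'//|SQ].
have [S' S'W fS] : P (f S); last by rewrite (transfer_inj SQ (WQ' _ S'W)).
apply: (@traceless_simple _ _ _ up n2 P sP) (fQ SQ).
- by move=> _ [S' /WQ' S'Q <-]; exact: fQ.
- exists (f (vpick W)); first by exists (vpick W) => //; exact: memv_pick.
  apply: contraNneq W0 => h; rewrite -vpick0; apply/eqP/f_inj => //.
  exact/WQ'/memv_pick.
Qed.

Lemma transfer_iso (W : {vspace tensor C n I}) (theta : {linear 'M[C]_n -> 'M[C]_n}) :
  (forall T, T \in W <-> traceless up T) ->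
  (forall A S, u A -> S \in Q -> f (S_act A S) = tact up (theta (gl A)) (f S)) ->
  iso_gl g J phi psi Q (rep up W \o theta).
Proof.
move=> WP fact; pose F S := vsproj W (f S).
have FP : GRing.linear_for (real_complex R \; *:%R) F.
  by move=> k x y; rewrite /F fP linearP.
pose FM := GRing.isLinear.Build R (S_space V) (subvs_of W) (real_complex R \; *:%R) F FP.
pose FL : {linear S_space V -> subvs_of W | real_complex R \; *:%R} := HB.pack F FM.
have FE S : S \in Q -> vsval (FL S) = f S.
  by move=> SQ; rewrite vsprojK //; apply/WP/fQ.
exists FL; split.
- by move=> S1 S2 h1 h2 h; apply: transfer_inj => //; rewrite -!FE // h.
- move=> y; have [S SQ fS] := f_surj ((WP _).1 (subvsP y)).
  by exists S => //; apply: val_inj; rewrite /= FE.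
- move=> A S uA SQ; apply: val_inj.
  have e1 : vsval (FL (S_act A S)) = f (S_act A S).
    by rewrite vsprojK // fact //; apply/WP/traceless_tact/fQ.
  by apply: (etrans e1); rewrite fact // -FE // -(vsval_rep WP).
Qed.

End Transfer.

End RealModules.

Lemma lincomb3_eq0 (R : comPzRingType) (k a b c a' b' c' : R) : a + b + c = 0 -> a' + b'
  + c' = 0 ->
  k * a + a' + (k * b + b') + (k * c + c') = 0.
Proof.
move=> h h'; transitivity (k * (a + b + c) + (a' + b' + c')); first by ring.
by rewrite h h' mulr0 addr0.
Qed.

Lemma lincomb2_eq0 (R : comPzRingType) (k a b a' b' : R) : a + b = 0 -> a' + b' = 0 ->
  k * a + a' + (k * b + b') = 0.
Proof.
move=> h h'; transitivity (k * (a + b) + (a' + b')); first by ring.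
by rewrite h h' mulr0 addr0.
Qed.

(** * The three summands *)

Section Decomposition.
Variables (R : realType) (n : nat) (V : vectType R) (g : {symmetric V}) (J : 'End(V)).
Local Notation C := (R[i]).
Variables (phi : {linear V -> 'cV[C]_n | real_complex R \; *:%R}) (psi : 'cV[C]_n -> V).
Variable z : 'I_n -> V.
Hypothesis n2 : (2 <= n)%N.
Hypothesis hJ : orthogonal_complex_structure g J.
Hypotheses (phiK : cancel phi psi) (psiK : cancel psi phi).
Hypothesis phiJ : forall v, phi (J v) = 'i%C *: phi v.
Local Notation herm := (herm g J).
Hypothesis zP : forall v b, phi v b 0 = herm v (z b).
Implicit Types (S : S_space V) (A : 'End(V)) (X Y Z W U v : V).
Local Notation "k %:C" := (real_complex R k).
Local Notation e := (basis_vec psi).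
Local Notation gl := (gl_mx phi psi).
Local Notation u := (u_algebra g J).
Local Notation nabla S := (nabla_curvature_space u S).
Local Notation Psi := (Psi J phi psi z).
Let g_nd := g_nondeg phiK zP.

Lemma nablaP k S1 S2 : nabla S1 -> nabla S2 -> nabla (k *: S1 + S2).
Proof.
move=> [c1 b1] [c2 b2]; split=> [X|X Y Z]; last first.
  apply/lfunP => W; apply: g_nd => U; rewrite !lfE zero_lfunE !gD !gZ g0.
  apply: lincomb3_eq0; [have := b1 X Y Z | have := b2 X Y Z];
    by move=> /(congr1 (fun f : 'End(V) => g (f W) U)); rewrite !lfE zero_lfunE !gD g0.
have [a1 u1 d1] := c1 X; have [a2 u2 d2] := c2 X.
split=> [Y|Y Z|Y Z W].
- by rewrite !lfE a1 a2 scaler0 addr0.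
- have [s1 _] := u1 Y Z; have [s2 _] := u2 Y Z; split.
    move=> W U; rewrite !lfE [g W (_ + _)]gC !gD !gZ; apply: lincomb2_eq0.
      by rewrite [X in _ + X]gC.
    by rewrite [X in _ + X]gC.
  apply/lfunP => W; rewrite !comp_lfunE !lfE.
  by rewrite (u_J _ (u1 Y Z)) (u_J _ (u2 Y Z)).
apply: g_nd => U; rewrite !lfE !gD !gZ g0.
by apply: lincomb3_eq0; rewrite -!gD ?d1 ?d2 g0.
Qed.

Lemma nabla0 : nabla 0.
Proof.
split=> [X|X Y Z]; rewrite ?zero_lfunE ?addr0 //; split=> [Y|Y Z|Y Z W];
  rewrite !zero_lfunE ?addr0 //.
split=> [x y|]; first by rewrite !zero_lfunE g0 gC g0 addr0.
by apply/lfunP => v; rewrite !comp_lfunE !zero_lfunE linear0.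
Qed.

Let hPsiP := Psi_is_rlinear hJ phiK zP.
Let hPsiD S1 S2 : Psi (S1 + S2) = Psi S1 + Psi S2 := rlinear_tensorD hPsiP S1 S2.
Let hPsi0 : Psi 0 = 0 := rlinear_tensor0 hPsiP.

Lemma Psi_inj S1 S2 : nabla S1 -> nabla S2 -> Psi S1 = Psi S2 -> S1 = S2.
Proof.
move=> h1 h2 h; apply/subr0_eq/(Psi_inj0 hJ phiK psiK phiJ zP).
  by rewrite -scaleN1r addrC; exact: nablaP.
by rewrite (rlinear_tensorB hPsiP) h subrr.
Qed.

Lemma Psi_surj T : sym5 T -> exists2 S, nabla S & Psi S = T.
Proof.
move=> sT; exists (Phi g J phi psi z T).
  exact: (Phi_nabla hJ phiK psiK phiJ zP sT).
exact: (Psi_Phi hJ phiK psiK phiJ zP).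
Qed.

Lemma sym_ins31 (l : tensor C n 'I_1) : sym5 (ins3 (ins1 l)).
Proof. by apply: sym_ins3; exact: sym_ins1. Qed.

Let n1 : n%:R + 1 != 0 :> C. Proof. by rewrite natr1 pnatr_eq0. Qed.
Let n3 : n%:R + 3 != 0 :> C. Proof. by rewrite -natrD pnatr_eq0 addn3. Qed.
Let n22 : 2 * n%:R + 4 != 0 :> C. Proof. by rewrite -natrM -natrD pnatr_eq0 addn_eq0
  andbF. Qed.

(** [proj3] and [proj1] recover the traceless tensor from which [Psi S] was inserted; the constants
    are those of [tr5_ins3] and [tr35_ins31]. *)
Definition proj3 S : tensor C n 'I_3 := (n%:R + 3)^-1 *: tr5 (Psi S).
Definition proj1 S : tensor C n 'I_1 := ((2 * n%:R + 4) * (n%:R + 1))^-1 *: tr3 (tr5 (Psi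
  S)).

Let tr5P k (T1 T2 : tensor C n 'I_5) : tr5 (k *: T1 + T2) = k *: tr5 T1 + tr5 T2.
Proof. exact: tr5_is_linear. Qed.
Let tr3P k (t1 t2 : tensor C n 'I_3) : tr3 (k *: t1 + t2) = k *: tr3 t1 + tr3 t2.
Proof. exact: tr3_is_linear. Qed.

Lemma proj3P : rlinear_tensor proj3.
Proof.
by move=> k S1 S2; rewrite /proj3 hPsiP tr5P scalerDr !scalerA mulrC.
Qed.

Lemma proj1P : rlinear_tensor proj1.
Proof.
by move=> k S1 S2; rewrite /proj1 hPsiP tr5P tr3P scalerDr !scalerA mulrC.
Qed.

Lemma proj3_ins S t : traceless up3 t -> Psi S = ins3 t -> proj3 S = t.
Proof.
move=> /traceless3P[st tt] h.
by rewrite /proj3 h tr5_ins3 // tt linear0 addr0 scalerA mulVf // scale1r.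
Qed.

Lemma proj1_ins S l : Psi S = ins3 (ins1 l) -> proj1 S = l.
Proof.
by move=> h; rewrite /proj1 h tr35_ins31 scalerA mulVf ?scale1r // mulf_neq0.
Qed.

Definition conjT (I : finType) (T : tensor C n I) : tensor C n I :=
  mkt (fun w => conjc (coef T w)).

Lemma coef_conjT (I : finType) (T : tensor C n I) w : coef (conjT T) w = conjc (coef T w).
Proof. by rewrite coefE. Qed.

Lemma conjT_tact (I : finType) (up : pred I) B (T : tensor C n I) :
  conjT (tact up B T) = tact up (map_mx conjc B) (conjT T).
Proof.
apply: tensorP => w; rewrite coefE !coef_tact rmorph_sum; apply: eq_bigr => s _.
rewrite rmorph_sum; apply: eq_bigr => c _; rewrite rmorphM coefE; congr (_ * _).
by rewrite /smx; case: (up s); rewrite !mxE ?rmorphN.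
Qed.

Lemma conjT_traceless (I : finType) (up : pred I) (T : tensor C n I) :
  traceless up T -> traceless up (conjT T).
Proof.
move=> [sT tT]; split=> [s t w h|s t w h]; first by rewrite !coefE sT.
under eq_bigr => c _ do rewrite coefE.
by rewrite -rmorph_sum tT // rmorph0.
Qed.

Lemma conjTK (I : finType) : involutive (@conjT I).
Proof. by move=> T; apply: tensorP => w; rewrite !coefE conjcK. Qed.

Definition dual_gram : 'M[C]_n := \matrix_(k, b) conjc (phi (z b) k 0).

(** Its inverse is the Gram matrix of the basis [e], found by expanding the antilinear functional
    [conjc (phi v k 0)] over the dual basis. *)
Lemma dual_gram_unit : dual_gram \in unitmx.
Proof.
have E : dual_gram *m (\matrix_(b, c) herm (e b) (e c)) = 1%:M.
  apply/matrixP => k c; rewrite !mxE.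
  have aL : antilinear J (fun v => conjc (phi v k 0)).
    have [h1 h2] := phi_clinear phiJ k.
    by split=> [r x y|x]; rewrite ?h1 ?h2 !(rmorphD, rmorphM) /=;
      congr (_ * _ + _) || congr (_ * _);
      apply: complexP; rewrite /= ?oppr0.
  have := antilinearE hJ phiK psiK phiJ zP (e c) aL.
  rewrite (phi_e psiK) rmorph_nat => ->; apply: eq_bigr => b _.
  by rewrite !mxE mulrC.
by case/mulmx1_unit: E.
Qed.

(** After multiplication by [dual_gram], both sides give the conjugate of coordinate k of [A (z b)]:
    one directly, the other by skewness for h. *)
Lemma conj_gl A : u A -> map_mx conjc (gl A) = dual_twist dual_gram (gl A).
Proof.
move=> uA; have uK := dual_gram_unit.
apply: (can_inj (mulmxK uK)); rewrite /dual_twist mulNmx mulmxKV //.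
apply/matrixP => k b; rewrite !mxE.
have AJ := u_J _ uA.
have phiA i v : phi (A v) i 0 = \sum_c gl A i c * phi v c 0.
  have cl : clinear J (fun v => phi (A v) i 0).
    by split=> [r x y|x]; [rewrite linearP phiP | rewrite AJ phiJ mxE].
  by rewrite (clinearE phiK psiK phiJ v cl); apply: eq_bigr => c _; rewrite mxE mulrC.
transitivity (conjc (phi (A (z b)) k 0)).
  by rewrite phiA rmorph_sum; apply: eq_bigr => c _; rewrite !mxE rmorphM.
rewrite zP -(hermC hJ) -[LHS]opprK -(u_herm _ _ uA) -zP phiA; congr (- _).
apply: eq_bigr => c _; rewrite !mxE mulrC; congr (_ * _).
by rewrite !zP -(hermC hJ).
Qed.

(** The vector that represents the covector [l] through h, see [herm_vec]. The map is antilinear, so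
    the dual of C^n becomes V as a real module. *)
Definition vec (l : tensor C n 'I_1) : V :=
  \sum_k (complex.Re (coef l (idx1 k)) *: z k - complex.Im (coef l (idx1 k)) *: J (z k)).

Lemma herm_vec l k : herm (e k) (vec l) = coef l (idx1 k).
Proof.
have aP := herm_antilinear hJ (e k).
rewrite (real_sum _ aP.1) (bigD1 k) //= big1 => [|j /negbTE jk].
  rewrite addr0 -scaleNr aP.1 (rlinearZ _ _ aP.1) aP.2 -zP (phi_e psiK) eqxx.
  by rewrite [RHS]complexE rmorphN /=; ring.
rewrite -scaleNr aP.1 (rlinearZ _ _ aP.1) aP.2 -zP (phi_e psiK) jk.
by rewrite !mulr0 addr0.
Qed.

Lemma herm_e_inj x y : (forall k, herm (e k) x = herm (e k) y) -> x = y.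
Proof.
move=> h; apply: (herm_inj phiK zP) => v.
rewrite (clinearE phiK psiK phiJ v (herm_clinear hJ x)).
rewrite (clinearE phiK psiK phiJ v (herm_clinear hJ y)).
by apply: eq_bigr => k _; rewrite h.
Qed.

Lemma vecP k l1 l2 : vec (k%:C *: l1 + l2) = k *: vec l1 + vec l2.
Proof.
apply: herm_e_inj => i; rewrite [RHS](hermPr hJ) (herm_vec l1) (herm_vec l2).
by rewrite herm_vec coefD coefZ.
Qed.

Lemma vec_tact A l : u A -> vec (tact up1 (gl A) l) = A (vec l).
Proof.
move=> uA; apply: herm_e_inj => k; rewrite herm_vec coef_tact1.
rewrite -[RHS]opprK -(u_herm _ _ uA); congr (- _).
rewrite (clinearE phiK psiK phiJ (A (e k)) (herm_clinear hJ (vec l))).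
by apply: eq_bigr => c _; rewrite herm_vec mxE.
Qed.

Lemma nabla_act A S : u A -> nabla S -> nabla (S_act A S).
Proof. by move=> uA hS; exact: (S_act_nabla hJ g_nd hS uA). Qed.

Lemma Psi_tact A S : u A -> nabla S -> Psi (S_act A S) = tact up5 (gl A) (Psi S).
Proof. by move=> uA hS; exact: (Psi_act hJ phiK psiK phiJ zP hS uA). Qed.

Lemma eps1 : \sum_s eps C up1 s = -1.
Proof. by rewrite /eps big_ord1. Qed.
Lemma eps3 : \sum_s eps C up3 s = -1.
Proof. by rewrite /eps sum_up3; ring. Qed.
Lemma eps5 : \sum_s eps C up5 s = -1.
Proof. by rewrite /eps sum_up5; ring. Qed.

Variables (W5 : {vspace tensor C n 'I_5}) (W3 : {vspace tensor C n 'I_3}).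
Hypothesis W5P : forall T, T \in W5 <-> traceless up5 T.
Hypothesis W3P : forall T, T \in W3 <-> traceless up3 T.

(** The twisted isomorphism, obtained from the conjugate of [Psi], serves the highest weight
    statement; the plain one serves n = 2, where [J] only has to square to -1. *)
Lemma exists_Q0 : exists Q : {vspace S_space V},
  [/\ forall S, S \in Q <-> nabla S /\ tr5 (Psi S) = 0,
      irreducible [set S_act A | A in u]%classic Q,
      iso_gl g J phi psi Q (rep up5 W5 \o idfun)
    & iso_gl g J phi psi Q (rep up5 W5 \o dual_twist dual_gram)].
Proof.
have [|k x y [hx tx] [hy ty]|Q QP] := @subspace_of_pred _ (S_space V)
    (fun S => nabla S /\ tr5 (Psi S) = 0).
- by split; [exact: nabla0 | rewrite hPsi0 linear0].
- by split; [exact: nablaP | rewrite hPsiP linearP /= tx ty scaler0 addr0].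
have Qtr S : S \in Q -> traceless up5 (Psi S).
  by move=> /QP[h t]; apply/traceless5P; split=> //; exact: (Psi_sym hJ phiK zP h).
have Qinj S : S \in Q -> Psi S = 0 -> S = 0.
  by move=> /QP[h _]; exact: (Psi_inj0 hJ phiK psiK phiJ zP h).
have Qsurj T : traceless up5 T -> exists2 S, S \in Q & Psi S = T.
  by move=> /traceless5P[sT tT]; have [S h ST] := Psi_surj sT; exists S => //; apply/QP;
    rewrite ST.
have Qact A S : u A -> S \in Q -> S_act A S \in Q.
  move=> uA /QP[h t]; apply/QP; split; first exact: nabla_act.
  by rewrite Psi_tact // tact_tr5 t linear0.
have Peq A S : u A -> S \in Q -> Psi (S_act A S) = tact up5 (gl A) (Psi S).
  by move=> uA /QP[h _]; exact: Psi_tact.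
exists Q; split=> //.
- exact: (transfer_irreducible n2 hJ phiK psiK phiJ zP hPsiP Qtr Qinj Qsurj Qact Peq
  eps5).
- exact: (transfer_iso hPsiP Qtr Qinj Qsurj W5P).
- apply: (transfer_iso (up := up5) (f := fun S => conjT (Psi S))) => //.
  + move=> k x y; apply: tensorP => w; rewrite hPsiP !(coefD, coefZ, coef_conjT).
    by rewrite !cE.
  + by move=> S SQ; exact/conjT_traceless/Qtr.
  + move=> S SQ h; apply: Qinj => //; rewrite -[Psi S]conjTK h.
    by apply: tensorP => w; rewrite coef_conjT !coef0 rmorph0.
  + move=> T hT; have [S SQ ST] := Qsurj _ (conjT_traceless hT).
    by exists S; rewrite ?ST ?conjTK.
  + by move=> A S uA SQ; rewrite Peq // conjT_tact conj_gl.
Qed.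

Lemma exists_Q' : exists Q : {vspace S_space V},
  [/\ forall S, S \in Q <-> nabla S /\ exists2 t, traceless up3 t & Psi S = ins3 t,
      irreducible [set S_act A | A in u]%classic Q
    & iso_gl g J phi psi Q (rep up3 W3 \o idfun)].
Proof.
have [sub0 subP _] := @traceless_submodule C n _ up3.
have [|k x y [hx [tx wx ex]] [hy [ty wy ey]]|Q QP] := @subspace_of_pred _ (S_space V)
    (fun S => nabla S /\ exists2 t, traceless up3 t & Psi S = ins3 t).
- by split; [exact: nabla0 | exists 0; rewrite ?hPsi0 ?linear0].
- split; first exact: nablaP.
  by exists (k%:C *: tx + ty); [exact: subP | rewrite hPsiP ex ey linearP].
have Qp S t : S \in Q -> Psi S = ins3 t -> traceless up3 t -> proj3 S = t.
  by move=> _ h ht; exact: proj3_ins.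
have Qtr S : S \in Q -> traceless up3 (proj3 S).
  by move=> /QP[h [t ht ST]]; rewrite (proj3_ins ht ST).
have Qinj S : S \in Q -> proj3 S = 0 -> S = 0.
  move=> /QP[h [t ht ST]]; rewrite (proj3_ins ht ST) => t0.
  by apply: (Psi_inj0 hJ phiK psiK phiJ zP h); rewrite ST t0 linear0.
have Qsurj T : traceless up3 T -> exists2 S, S \in Q & proj3 S = T.
  move=> hT; have [sT _] := (traceless3P _).1 hT.
  have [S h ST] := Psi_surj (sym_ins3 sT).
  by exists S; [apply/QP; split=> //; exists T | exact: proj3_ins].
have Qact A S : u A -> S \in Q -> S_act A S \in Q.
  move=> uA /QP[h [t ht ST]]; apply/QP; split; first exact: nabla_act.
  by exists (tact up3 (gl A) t);
    [exact: traceless_tact | rewrite Psi_tact // ST tact_ins3].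
have Peq A S : u A -> S \in Q -> proj3 (S_act A S) = tact up3 (gl A) (proj3 S).
  by move=> uA /QP[h _]; rewrite /proj3 Psi_tact // tact_tr5 linearZ.
exists Q; split=> //.
- exact: (transfer_irreducible n2 hJ phiK psiK phiJ zP proj3P Qtr Qinj Qsurj Qact Peq
  eps3).
- exact: (transfer_iso proj3P Qtr Qinj Qsurj W3P).
Qed.

Lemma exists_Q1 : exists Q : {vspace S_space V},
  [/\ forall S, S \in Q <-> nabla S /\ exists l, Psi S = ins3 (ins1 l),
      irreducible [set S_act A | A in u]%classic Q
    & iso_standard g J Q].
Proof.
have [|k x y [hx [tx ex]] [hy [ty ey]]|Q QP] := @subspace_of_pred _ (S_space V)
    (fun S => nabla S /\ exists l, Psi S = ins3 (ins1 l)).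
- by split; [exact: nabla0 | exists 0; rewrite hPsi0 !linear0].
- split; first exact: nablaP.
  by exists (k%:C *: tx + ty); rewrite hPsiP ex ey !linearP.
have Qtr S : S \in Q -> traceless up1 (proj1 S) by move=> _; exact: traceless1.
have Qinj S : S \in Q -> proj1 S = 0 -> S = 0.
  move=> /QP[h [l ST]]; rewrite (proj1_ins ST) => l0.
  by apply: (Psi_inj0 hJ phiK psiK phiJ zP h); rewrite ST l0 !linear0.
have Qsurj T : traceless up1 T -> exists2 S, S \in Q & proj1 S = T.
  move=> _; have [S h ST] := Psi_surj (sym_ins31 T).
  by exists S; [apply/QP; split=> //; exists T | exact: proj1_ins].
have Qact A S : u A -> S \in Q -> S_act A S \in Q.
  move=> uA /QP[h [l ST]]; apply/QP; split; first exact: nabla_act.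
  by exists (tact up1 (gl A) l); rewrite Psi_tact // ST tact_ins3 tact_ins1.
have Peq A S : u A -> S \in Q -> proj1 (S_act A S) = tact up1 (gl A) (proj1 S).
  by move=> uA /QP[h _]; rewrite /proj1 Psi_tact // tact_tr5 tact_tr3 linearZ.
exists Q; split=> //.
  exact: (transfer_irreducible n2 hJ phiK psiK phiJ zP proj1P Qtr Qinj Qsurj Qact Peq
    eps1).
pose F S := vec (proj1 S).
have FP : linear F.
  by move=> k x y; rewrite /F proj1P vecP.
pose FM := GRing.isLinear.Build R (S_space V) V *:%R F FP.
pose FL : {linear S_space V -> V} := HB.pack F FM.
have vec_inj l l' : vec l = vec l' -> l = l'.
  by move=> h; apply: tensor1P => i; rewrite -!herm_vec h.
exists FL; split.
- by move=> S1 S2 h1 h2 /vec_inj; exact: (transfer_inj proj1P Qinj).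
- move=> y; have [S SQ ST] := Qsurj (mk1 (fun k => herm (e k) y)) (@traceless1 _ _ _).
  by exists S => //; apply: herm_e_inj => k; rewrite /= /F ST herm_vec coef_mk1.
- by move=> A S uA SQ; rewrite /= /F Peq // vec_tact.
Qed.

Theorem decomposition : exists Q0 Q' Q1 : {vspace S_space V},
  [/\ irreducible_decomposition g J Q0 Q' Q1,
      iso_gl g J phi psi Q0 (rep up5 W5 \o idfun) /\
        iso_gl g J phi psi Q0 (rep up5 W5 \o dual_twist dual_gram),
      iso_gl g J phi psi Q' (rep up3 W3 \o idfun)
    & iso_standard g J Q1].
Proof.
have [Q0 [Q0P irr0 iso0 iso0']] := exists_Q0.
have [Q' [Q'P irr' iso']] := exists_Q'.
have [Q1 [Q1P irr1 iso1]] := exists_Q1.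
exists Q0, Q', Q1.
split; [|split; [exact: iso0|exact: iso0']|exact: iso'|exact: iso1].
split; [| |exact: irr0|exact: irr'|exact: irr1].
- apply/seteqP; split=> S /=.
    move=> hS; have sS := Psi_sym hJ phiK zP hS.
    have [T0 [t [l [tT0 tt TE]]]] := symmetric_decomposition sS.
    have [sT0 trT0] := (traceless5P _).1 tT0; have [st _] := (traceless3P _).1 tt.
    have [S0 h0 e0] := Psi_surj sT0.
    have [S' h' e'] := Psi_surj (sym_ins3 st).
    have [S1 h1 e1] := Psi_surj (sym_ins31 l).
    have nD x y : nabla x -> nabla y -> nabla (x + y).
      by move=> hx hy; rewrite -[x]scale1r; exact: nablaP.
    have -> : S = S0 + S' + S1.
      apply: Psi_inj => //; first by apply: (nD) => //; exact: nD.
      by rewrite !hPsiD e0 e' e1.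
    apply: memv_add; first apply: memv_add.
    + by apply/Q0P; rewrite e0.
    + by apply/Q'P; split=> //; exists t.
    + by apply/Q1P; split=> //; exists l.
  move=> /memv_addP[_ /memv_addP[S0 /Q0P[h0 _] [S' /Q'P[h' _] ->]] [S1 /Q1P[h1 _] ->]].
  rewrite -[S0]scale1r -[_ + S']scale1r; apply: nablaP => //.
  exact: nablaP.
- rewrite !directv_addE /=; apply/and3P; split; [apply/and3P; split| |];
  rewrite ?directvE //=.
    apply/eqP/vspaceP => S; rewrite memv0 memv_cap; apply/andP/eqP => [|->];
      last by rewrite !mem0v.
    move=> [/Q0P[h t0] /Q'P[_ [t ht ST]]].
    apply: (Psi_inj0 hJ phiK psiK phiJ zP h).
    by rewrite ST -(proj3_ins ht ST) /proj3 t0 scaler0 linear0.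
  apply/eqP/vspaceP => S; rewrite memv0 memv_cap; apply/andP/eqP => [|->];
    last by rewrite !mem0v.
  move=> [/memv_addP[S0 /Q0P[h0 t0] [S' /Q'P[h' [t ht ST]] ->]] /Q1P[h [l Sl]]].
  (* [proj1] vanishes on the sum of the first two summands, because there [tr5] of the tensor is
     traceless, but it determines the elements of the third. *)
  apply: (Psi_inj0 hJ phiK psiK phiJ zP h).
  have [st tt] := (traceless3P _).1 ht.
  have trS : tr5 (Psi (S0 + S')) = (n%:R + 3) *: t.
    by rewrite hPsiD linearD /= t0 add0r ST tr5_ins3 // tt linear0 addr0.
  have ltr : tr3 ((n%:R + 3) *: t) = 0 by rewrite linearZ /= tt; exact: scaler0.
  by rewrite Sl -(proj1_ins Sl) /proj1 trS ltr scaler0 !linear0.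
Qed.

End Decomposition.

(** * Dual basis and the case n = 2 *)

Section Conclusion.
Variables (R : realType) (n : nat) (V : vectType R) (g : {symmetric V}) (J : 'End(V)).
Variables (phi : {linear V -> 'cV[R[i]]_n | real_complex R \;
  *:%R}) (psi : 'cV[R[i]]_n -> V).
Hypothesis n2 : (2 <= n)%N.
Hypothesis hJ : orthogonal_complex_structure g J.
Hypotheses (phiK : cancel phi psi) (psiK : cancel psi phi).
Hypothesis phiJ : forall v, phi (J v) = 'i%C *: phi v.

(** It suffices that [z b] represents the real part of coordinate b for g: replacing v by [J v]
    yields the imaginary part. *)
Lemma exists_dual_basis r s : signature g r s ->
  exists z : 'I_n -> V, forall v b, phi v b 0 = herm g J v (z b).
Proof.
move=> hg.
have /choice[z hz] : forall b, exists z, forall v, g v z = complex.Re (phi v b 0).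
  move=> b; apply: (signature_riesz hg) => k x y.
  rewrite linearP !mxE; move: (phi x b 0) (phi y b 0) => [a1 a2] [b1 b2] /=.
  by rewrite mul0r subr0.
exists z => v b; apply: complexP; rewrite /herm /= ?hz //.
have := hz b (J v); rewrite gJ // phiJ mxE.
by move: (phi v b 0) => [a1 a2] /=; rewrite mul0r mul1r sub0r => /oppr_inj.
Qed.

(** Stated for a variable [m], so that the equation with 2 can be substituted although the ambient
    dimension is p + q. *)
Lemma dim_traceless_binary (m : nat) (I : finType) (up : pred I)
    (W : {vspace tensor R[i] m I}) : m = 2%N ->
  (forall T, T \in W <-> traceless up T) -> \dim W = #|I|.+1.
Proof. by move=> m2; subst m; exact: dim_traceless2. Qed.

Lemma iso_C_traceless (I : finType) (up : pred I) (W : {vspace tensor R[i] n I})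
    (Q : {vspace S_space V}) : n = 2%N -> \sum_s eps R[i] up s = -1 ->
  (forall T, T \in W <-> traceless up T) ->
  iso_gl g J phi psi Q (rep up W \o idfun) -> iso_C g J phi psi Q #|I|.+1.
Proof.
move=> n_eq2 eps_up WP iso; exists (subvs_of W), (rep up W \o idfun).
split; [|rewrite dimvf; exact: dim_traceless_binary WP| |exact: iso].
  by apply: rep_irreducible => //= B; exists B.
move=> v; apply: val_inj; rewrite (gl_J psiK phiJ) /= !(vsval_rep WP).
rewrite !tact_scalar eps_up scalerA -[RHS]scaleN1r; congr (_ *: _).
by apply: complexP => /=; ring.
Qed.

End Conclusion.

Theorem theorem3 (R : realType) (p q : nat) (V : vectType R)
    (g : {symmetric V}) (J : 'End(V))
    (phi : {linear V -> 'cV[R[i]]_(p + q) | real_complex R \; *:%R})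
    (psi : 'cV[R[i]]_(p + q) -> V)
    (hn : (2 <= p + q)%N)
    (hg : signature g (2 * p) (2 * q))
    (hJ : orthogonal_complex_structure g J)
    (phiK : cancel phi psi) (psiK : cancel psi phi)
    (phiJ : forall v, phi (J v) = 'i%C *: phi v) :
  ((3 <= p + q)%N ->
     exists Q0 Q' Q1 : {vspace S_space V},
       [/\ irreducible_decomposition g J Q0 Q' Q1,
           iso_V g J phi psi Q0 3 2,
           iso_V g J phi psi Q' 1 2
         & iso_standard g J Q1]) /\
  ((p + q)%N = 2%N ->
     exists Q0 Q' Q1 : {vspace S_space V},
       [/\ irreducible_decomposition g J Q0 Q' Q1,
           iso_C g J phi psi Q0 6,
           iso_C g J phi psi Q' 4
         & iso_standard g J Q1]).
Proof.
have [z zP] := exists_dual_basis hJ phiJ hg.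
have [sub0 subP _] := @traceless_submodule R[i] (p + q) _ up5.
have [W5 W5P] := subspace_of_pred sub0 subP.
have [sub0' subP' _] := @traceless_submodule R[i] (p + q) _ up3.
have [W3 W3P] := subspace_of_pred sub0' subP'.
have [Q0 [Q' [Q1 [dec [iso0 iso0'] iso' iso1]]]] :=
  decomposition hn hJ phiK psiK phiJ zP W5P W3P.
have uK := dual_gram_unit hJ phiK psiK phiJ zP.
split=> [_|n2]; exists Q0, Q', Q1.
  split; [exact: dec| | |exact: iso1].
    exists (subvs_of W5), (rep up5 W5 \o dual_twist (dual_gram phi z)).
    by split; [exact: is_V32|exact: iso0'].
  exists (subvs_of W3), (rep up3 W3 \o idfun).
  by split; [exact: is_V12|exact: iso'].
split; [exact: dec| | |exact: iso1].
  by have := iso_C_traceless hn psiK phiJ n2 (eps5 R) W5P iso0; rewrite card_ord.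
by have := iso_C_traceless hn psiK phiJ n2 (eps3 R) W3P iso'; rewrite card_ord.
Qed.
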